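(* Let $x,\gamma\in(0,\infty)$. Among all $f\in\mathcal{A}^x$ satisfying $\Gamma_{0,x}(f)\le\gamma$, there is a unique maximizer of $A_{0,x}(f)$, namely \[f^\star_{x,\gamma}(u)=\sqrt{\frac{3\gamma}{x^3}}\,u(x-u),\qquad 0\le u\le x,\] and it satisfies $\Gamma_{0,x}(f^\star_{x,\gamma})=\gamma$ and $A_{0,x}(f^\star_{x,\gamma})=\sqrt{3\gamma x^3}/6$.
   Context: For $x>0$, $\mathcal{A}^x$ is the set of absolutely continuous $f:[0,x]\to\mathbb{R}$ with $f(0)=0$ and $\int_0^xf'(u)^2du<\infty$. For $f\in\mathcal{A}^x$, $\overline f$ and $\underline f$ denote the least concave majorant and greatest convex minorant of $f$ on $[0,x]$. $A_{0,x}(f):=\int_0^x(\overline f(u)-\underline f(u))\,du$ (the area of the convex hull of the graph of $f$) and $\Gamma_{0,x}(f):=\int_0^xf'(u)^2\,du$.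
   Formalization: Uniqueness of the maximizer is stated up to sign: since −f* also satisfies the constraint and has the same convex hull area, any maximizer equals f* or −f* on [0,x]. *)

(* Defs.v *)
From HB Require Import structures.
From mathcomp Require Import all_boot all_order all_algebra.
From mathcomp Require Import all_classical all_reals all_analysis.
Set Implicit Arguments. Unset Strict Implicit. Unset Printing Implicit Defensive.
Import Order.TTheory GRing.Theory Num.Theory.
Import numFieldNormedType.Exports.
Local Open Scope classical_set_scope.
Local Open Scope ring_scope.

Section Defs.
Variable R : realType.

Definition abs_cont_on (a b : R) (f : R -> R) : Prop :=
  forall e : R, 0 < e -> exists2 d : R, 0 < d &
    forall (n : nat) (s t : nat -> R),
      (forall i, (i < n)%N -> a <= s i /\ s i <= t i /\ t i <= b) ->
      (forall i j, (i < j)%N -> (j < n)%N -> t i <= s j) ->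
      \sum_(i < n) (t i - s i) < d ->
      \sum_(i < n) `|f (t i) - f (s i)| < e.

Definition Gamma (x : R) (f : R -> R) : \bar R :=
  (\int[@lebesgue_measure R]_(u in `[0%R, x]%classic) ((derive1 f u) ^+ 2)%:E)%E.

Definition Acl (x : R) (f : R -> R) : Prop :=
  abs_cont_on 0 x f /\ f 0 = 0 /\ (Gamma x f < +oo)%E.

Definition concave_on (a b : R) (h : R -> R) : Prop :=
  forall u v t, a <= u <= b -> a <= v <= b -> 0 <= t <= 1 ->
    t * h u + (1 - t) * h v <= h (t * u + (1 - t) * v).

Definition convex_on (a b : R) (h : R -> R) : Prop :=
  forall u v t, a <= u <= b -> a <= v <= b -> 0 <= t <= 1 ->
    h (t * u + (1 - t) * v) <= t * h u + (1 - t) * h v.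

Definition lcmaj (x : R) (f : R -> R) (u : R) : R :=
  inf [set h u | h in [set h : R -> R | concave_on 0 x h /\
        forall v, 0 <= v <= x -> f v <= h v]].

Definition gcmin (x : R) (f : R -> R) (u : R) : R :=
  sup [set h u | h in [set h : R -> R | convex_on 0 x h /\
        forall v, 0 <= v <= x -> h v <= f v]].

Definition Area (x : R) (f : R -> R) : \bar R :=
  (\int[@lebesgue_measure R]_(u in `[0%R, x]%classic) (lcmaj x f u - gcmin x f u)%:E)%E.

Definition fstar (x gamma : R) (u : R) : R :=
  Num.sqrt (3 * gamma / x ^+ 3) * u * (x - u).

End Defs.

(* Main.v *)
(** Write M and m for the least concave majorant and the greatest convex minorant
    of f, and c(u) = u - x/2.  As M - m vanishes at 0 and x, the area of the hull
    is <c, m' - M'>, so by Cauchy-Schwarz it is at most |c| |M' - m'|, where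
    |c|^2 = x^3/12.  Now M is affine off the contact set {M = f}, whence
    <M', M' - f'> = 0, and likewise <m', m' - f'> = 0; therefore
    |M' - m'|^2 + |f' - M' - m'|^2 = |f'|^2 <= gamma, which gives the bound.

    In the case of equality f = M + m and M - m is the parabola P = fstar.  At an
    interior point with |f| < P both hulls would be affine nearby, contradicting
    the strict concavity of P; so f = P or f = - P pointwise, and globally by the
    intermediate value theorem.

    To avoid differentiating M and m, all this is done on the uniform grid of
    mesh x/n, with discrete hulls, before letting n tend to infinity.  The only
    input on Gamma is that it dominates the sums of (f v - f u)^2 / (v - u) over
    partitions, which rests on f being the integral of its almost everywhere
    defined derivative: f is a difference of nondecreasing absolutely continuous
    functions, whose Lebesgue-Stieltjes measures have densities by Radon-Nikodym;
    Lebesgue differentiation identifies the density with f'. *)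
Require Import Defs.
From HB Require Import structures.
From mathcomp Require Import all_boot all_order all_algebra.
From mathcomp Require Import all_classical all_reals all_analysis.
From mathcomp Require Import measurable_realfun ring lra.
Import Order.TTheory GRing.Theory Num.Theory.
Import numFieldNormedType.Exports.
Local Open Scope classical_set_scope.
Local Open Scope ring_scope.

Set Implicit Arguments.
Unset Strict Implicit.

(** * Discrete concave majorants *)

Section DiscreteMajorant.
Variable R : realType.
Implicit Types (f g h M D phi : nat -> R) (n i j k : nat).

Definition seq_concave n h := forall i, (i.+2 <= n)%N ->
  h i + h i.+2 <= 2 * h i.+1.

Definition seq_cmaj n f i : R :=
  inf [set h i | h in [set h : nat -> R | seq_concave n h /\
        forall j, (j <= n)%N -> f j <= h j]].

Lemma seq_cmaj_neq0 n f i :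
  [set h i | h in [set h : nat -> R | seq_concave n h /\
        forall j, (j <= n)%N -> f j <= h j]] !=set0.
Proof.
exists (\sum_(j < n.+1) `|f j|), (fun=> \sum_(j < n.+1) `|f j|) => //.
split=> [k _|j jn]; first by lra.
rewrite (le_trans (ler_norm _))// (bigD1 (Ordinal (jn : (j < n.+1)%N)))//=.
by rewrite lerDl sumr_ge0.
Qed.

Lemma seq_cmaj_ge n f i : (i <= n)%N -> f i <= seq_cmaj n f i.
Proof.
move=> i_n; apply: lb_le_inf; first exact: seq_cmaj_neq0.
by move=> _ [h [_ fh] <-]; exact: fh.
Qed.

Lemma seq_cmaj_le n f h i : (i <= n)%N -> seq_concave n h ->
  (forall j, (j <= n)%N -> f j <= h j) -> seq_cmaj n f i <= h i.
Proof.
move=> i_n ch fh; apply: ge_inf; last by exists h.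
by exists (f i) => _ [k [_ fk] <-]; exact: fk.
Qed.

Lemma seq_cmaj_concave n f : seq_concave n (seq_cmaj n f).
Proof.
move=> i i_n; rewrite -ler_pdivrMl//.
apply: lb_le_inf; first exact: seq_cmaj_neq0.
move=> _ [h [ch fh] <-]; rewrite ler_pdivrMl//.
by rewrite (le_trans _ (ch _ i_n))// lerD// seq_cmaj_le// ltnW// ltnW.
Qed.

(** Complementary slackness: otherwise the value at [i.+1] could be lowered to [c], giving a smaller
    concave majorant. *)
Lemma seq_cmaj_slack n f i : (i.+2 <= n)%N -> f i.+1 < seq_cmaj n f i.+1 ->
  seq_cmaj n f i + seq_cmaj n f i.+2 = 2 * seq_cmaj n f i.+1.
Proof.
move=> i_n fM; apply/eqP; rewrite eq_le seq_cmaj_concave//= leNgt.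
apply/negP => lt.
pose c := Num.max (f i.+1) ((seq_cmaj n f i + seq_cmaj n f i.+2) / 2).
have cM : c < seq_cmaj n f i.+1 by rewrite gt_max fM/= ltr_pdivrMr// mulrC.
pose h j := if j == i.+1 then c else seq_cmaj n f j.
suff : seq_cmaj n f i.+1 <= h i.+1 by rewrite /h eqxx leNgt cM.
have hM j : h j <= seq_cmaj n f j by rewrite /h; case: eqP => // ->; exact: ltW.
apply: seq_cmaj_le; [exact: ltnW| |].
(* Only the triple centred at [i.+1] has its middle value lowered, and there [c] is at least the
   midpoint of the chord; in all other triples only outer values can decrease. *)
- move=> j jn; case: (eqVneq j i) => [->|ji].
    rewrite /h eqxx (ltn_eqF (ltnSn i)) (gtn_eqF (ltnSn i.+1)).
    have : (seq_cmaj n f i + seq_cmaj n f i.+2) / 2 <= c by rewrite le_max lexx orbT.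
    by rewrite ler_pdivrMr// mulrC.
  have -> : h j.+1 = seq_cmaj n f j.+1 by rewrite /h eqSS (negbTE ji).
  by rewrite (le_trans _ (seq_cmaj_concave _ jn))// lerD.
- move=> j jn; rewrite /h; case: eqP => [->|_]; last exact: seq_cmaj_ge.
  by rewrite le_max lexx.
Qed.

(** Together the hypotheses say that [k] is [0] or [n]. Such an index is never the middle of a
    triple, so lowering the value there to [f k] keeps concavity. *)
Lemma seq_cmaj_lower n f k : (k <= n)%N -> (forall i, i.+1 = k -> (k < n)%N -> False) ->
  seq_cmaj n f k = f k.
Proof.
move=> kn kb; apply/eqP; rewrite eq_le seq_cmaj_ge// andbT.
pose h j := if j == k then f k else seq_cmaj n f j.
have hM j : (j <= n)%N -> h j <= seq_cmaj n f j.
  by rewrite /h; case: eqP => // -> _; exact: seq_cmaj_ge.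
have -> : f k = h k by rewrite /h eqxx.
apply: seq_cmaj_le => //.
- move=> j jn; have -> : h j.+1 = seq_cmaj n f j.+1.
    by rewrite /h; case: eqP => // jk; case: (kb j jk); rewrite -jk.
  by rewrite (le_trans _ (seq_cmaj_concave _ jn))// lerD ?hM// ltnW// ltnW.
- by move=> j jn; rewrite /h; case: eqP => [->|_] //; exact: seq_cmaj_ge.
Qed.

Lemma seq_cmaj0 n f : seq_cmaj n f 0 = f 0.
Proof. by apply: seq_cmaj_lower. Qed.

Lemma seq_cmajn n f : seq_cmaj n f n = f n.
Proof. by apply: seq_cmaj_lower => // i _; rewrite ltnn. Qed.

(** The increments of [h] are nonincreasing; they are summed to the right of [i] and then to the
    left of it. *)
Lemma seq_concave_tangent n h i j : seq_concave n h -> (i < n)%N -> (j <= n)%N ->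
  h j <= h i + (j%:R - i%:R) * (h i.+1 - h i).
Proof.
move=> ch i_n j_n.
have dec k l : (l < n)%N -> (k <= l)%N -> h l.+1 - h l <= h k.+1 - h k.
  elim: l => [|l IH] ln; first by rewrite leqn0 => /eqP ->.
  rewrite leq_eqVlt => /predU1P[->//|]; rewrite ltnS => kl.
  by have := ch l ln; have := IH (ltnW ln) kl; lra.
have [ij|ji] := leqP i j.
  elim: j ij j_n => [|j IH]; first by rewrite leqn0 => /eqP ->; lra.
  rewrite leq_eqVlt => /predU1P[<- _|]; first by rewrite subrr mul0r addr0.
  rewrite ltnS => ij jn; have := IH ij (ltnW jn); have := dec i j jn ij.
  by rewrite -[j.+1%:R]natr1; lra.
elim: i i_n ji {j_n} => // i IH i_n; rewrite ltnS leq_eqVlt => /predU1P[->|ji].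
  by have := ch i i_n; rewrite -[i.+1%:R]natr1; lra.
have := IH (ltnW i_n) ji; have := ch i i_n; rewrite -[i.+1%:R]natr1.
have : (j%:R : R) <= i%:R by rewrite ler_nat ltnW.
by nra.
Qed.

(** Discrete integration by parts: the second difference of [M] vanishes wherever [phi] does not, so
    only the boundary term is left. *)
Lemma sum_by_parts n M phi : phi 0%N = 0 ->
  (forall i, (i.+2 <= n.+1)%N -> phi i.+1 * (M i + M i.+2 - 2 * M i.+1) = 0) ->
  \sum_(i < n.+1) (M i.+1 - M i) * (phi i.+1 - phi i) =
  (M n.+1 - M n) * phi n.+1.
Proof.
move=> phi0; elim: n => [_|n IH h]; first by rewrite big_ord1 phi0 subr0.
rewrite big_ord_recr/= IH; last by move=> i i_n; apply: h; exact: leqW.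
by have := h n (leqnn _); nra.
Qed.

(** Summation by parts with [phi = M - f]: it vanishes at both ends, and at an interior index either
    it is zero or [M] has zero second difference. *)
Lemma seq_cmaj_orthogonal n f :
  \sum_(i < n) (seq_cmaj n f i.+1 - seq_cmaj n f i) *
    ((seq_cmaj n f i.+1 - seq_cmaj n f i) - (f i.+1 - f i)) = 0.
Proof.
case: n => [|n]; first by rewrite big_ord0.
set M := seq_cmaj n.+1 f.
transitivity (\sum_(i < n.+1) (M i.+1 - M i) *
    ((fun j => M j - f j) i.+1 - (fun j => M j - f j) i)).
  by apply: eq_bigr => i _; congr (_ * _); lra.
rewrite (@sum_by_parts n M (fun j => M j - f j)) /M ?seq_cmaj0 ?seq_cmajn ?subrr ?mulr0//.
move=> i i_n; have := seq_cmaj_ge f (ltnW i_n).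
rewrite le_eqVlt => /predU1P[<-|fM]; first by rewrite subrr mul0r.
by rewrite seq_cmaj_slack// subrr mulr0.
Qed.

Definition seq_cmin n f i : R := - seq_cmaj n (fun j => - f j) i.

(** For increments $a, b, c$ of [M], [m], [f] one has $(a-b)^2 + (c-a-b)^2 = c^2 + 2a(a-c) +
    2b(b-c)$. The last two terms sum to zero by orthogonality for [f] and for [- f]. *)
Lemma seq_hull_energy n f :
  let M := seq_cmaj n f in let m := seq_cmin n f in
  \sum_(i < n) ((M i.+1 - m i.+1) - (M i - m i)) ^+ 2 +
  \sum_(i < n) ((f i.+1 - M i.+1 - m i.+1) - (f i - M i - m i)) ^+ 2 =
  \sum_(i < n) (f i.+1 - f i) ^+ 2.
Proof.
move=> M m; rewrite -big_split/=.
rewrite -[RHS]addr0 -[X in _ + X](mulr0 2) -[X in _ = _ + 2 * X](addr0 0).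
rewrite -[X in 2 * (X + _)](seq_cmaj_orthogonal n f).
rewrite -[X in 2 * (_ + X)](seq_cmaj_orthogonal n (fun j => - f j)).
rewrite -big_split/= mulr_sumr -big_split/=; apply: eq_bigr => i _.
by rewrite /M /m /seq_cmin; ring.
Qed.

Lemma sum_abel n D : \sum_(i < n) (i%:R + 1) * (D i.+1 - D i) =
  n%:R * D n - \sum_(i < n) D i.
Proof.
elim: n => [|n IH]; first by rewrite !big_ord0; lra.
by rewrite !big_ord_recr/= IH -natr1; lra.
Qed.

Lemma sum_shift_sqr (c : R) n : \sum_(i < n) (c - i%:R) ^+ 2 =
  n%:R * c ^+ 2 - c * n%:R * (n%:R - 1) + n%:R * (n%:R - 1) * (2 * n%:R - 1) / 6.
Proof.
elim: n => [|n IH]; first by rewrite big_ord0; field.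
by rewrite big_ord_recr/= IH -natr1; field.
Qed.

(** The numbers [k * ((n - 1) / 2 - i)] are the increments of a parabola vanishing at [0] and [n].
    The square is expanded, the cross term is an Abel sum, and $\sum_i ((n-1)/2-i)^2 = (n^3-n)/12$
    is rounded up. *)
Lemma sum_dist_parabola_le n D (k : R) : D 0%N = 0 -> D n = 0 ->
  \sum_(i < n) ((D i.+1 - D i) - k * ((n%:R - 1) / 2 - i%:R)) ^+ 2 <=
  \sum_(i < n) (D i.+1 - D i) ^+ 2 - 2 * k * \sum_(i < n) D i
    + k ^+ 2 * n%:R ^+ 3 / 12.
Proof.
move=> D0 Dn; set c := (n%:R - 1) / 2.
have S : \sum_(i < n) (c - i%:R) * (D i.+1 - D i) = \sum_(i < n) D i.
  transitivity ((c + 1) * \sum_(i < n) (D i.+1 - D i)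
                - \sum_(i < n) (i%:R + 1) * (D i.+1 - D i)).
    rewrite mulr_sumr -sumrB; apply: eq_bigr => i _; ring.
  have := @telescope_sumr R 0 n D (leq0n _); rewrite big_mkord => ->.
  by rewrite sum_abel D0 Dn; ring.
have -> : \sum_(i < n) ((D i.+1 - D i) - k * (c - i%:R)) ^+ 2 =
  \sum_(i < n) (D i.+1 - D i) ^+ 2 - 2 * k * \sum_(i < n) D i
    + k ^+ 2 * \sum_(i < n) (c - i%:R) ^+ 2.
  rewrite -S !mulr_sumr -sumrB -big_split/=.
  by apply: eq_bigr => i _; ring.
rewrite lerD2l -[leRHS]mulrA; apply: ler_wpM2l; first exact: sqr_ge0.
rewrite sum_shift_sqr /c -subr_ge0.
by rewrite [leRHS](_ : _ = n%:R / 12) ?divr_ge0//; field.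
Qed.

(** Discrete Cauchy-Schwarz inequality; it turns a mean square bound on increments into a uniform
    bound. *)
Lemma sqr_le_sum_sqr n k g : (k <= n)%N -> g 0%N = 0 ->
  g k ^+ 2 <= n%:R * \sum_(i < n) (g i.+1 - g i) ^+ 2.
Proof.
move=> kn g0; apply: (@le_trans _ _ (k%:R * \sum_(i < k) (g i.+1 - g i) ^+ 2)).
  elim: k {kn} => [|k IH]; first by rewrite g0 big_ord0 expr0n mulr0.
  rewrite big_ord_recr/=; set S := \sum_(_ < _) _ in IH *.
  have S0 : 0 <= S by rewrite sumr_ge0// => *; exact: sqr_ge0.
  set d := g k.+1 - g k; have -> : g k.+1 = g k + d by rewrite /d; ring.
  rewrite -natr1; move: IH; set K : R := k%:R.
  have K0 : 0 <= K by rewrite /K.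
  have [KS|KS] := eqVneq K 0.
    rewrite KS mul0r => g2; have -> : g k = 0.
      by apply/eqP; rewrite -sqrf_eq0 eq_le g2 sqr_ge0.
    by nra.
  have Kp : 0 < K by rewrite lt_def KS.
  (* AM-GM: [2 g d <= g^2 / K + K d^2] *)
  have : 0 <= K^-1 * (g k - K * d) ^+ 2 by rewrite mulr_ge0 ?invr_ge0// sqr_ge0.
  rewrite [X in 0 <= X -> _](_ : _ = g k ^+ 2 / K - 2 * g k * d + K * d ^+ 2); last by field.
  move=> A IH; have : g k ^+ 2 / K <= S by rewrite ler_pdivrMr// mulrC.
  by nra.
have leS : \sum_(i < k) (g i.+1 - g i) ^+ 2 <= \sum_(i < n) (g i.+1 - g i) ^+ 2.
  rewrite -(subnKC kn) big_split_ord/= lerDl sumr_ge0// => *; exact: sqr_ge0.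
rewrite ler_pM// ?ler_nat// sumr_ge0// => *; exact: sqr_ge0.
Qed.

Lemma seq_affine h a b :
  (forall j, (a <= j)%N -> (j.+2 <= b)%N -> h j + h j.+2 = 2 * h j.+1) ->
  forall t, (a + t <= b)%N -> h (a + t)%N = h a + t%:R * (h a.+1 - h a).
Proof.
move=> H t; elim/ltn_ind: t => -[|[|t]] IH le.
- by rewrite addn0 mul0r addr0.
- by rewrite addn1 mul1r subrKC.
have := H (a + t)%N (leq_addr _ _); rewrite -!addnS => /(_ le).
have l1 : (a + t.+1 <= b)%N by rewrite (leq_trans _ le)// leq_add2l.
have l2 : (a + t <= b)%N by rewrite (leq_trans _ l1)// leq_add2l.
rewrite (IH t.+1)// (IH t)// => E.
have -> : h (a + t.+2)%N =
  2 * (h a + t.+1%:R * (h a.+1 - h a)) - (h a + t%:R * (h a.+1 - h a)) by lra.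
by rewrite -[t.+2%:R]natr1 -[t.+1%:R]natr1; ring.
Qed.

End DiscreteMajorant.

(** * Absolutely continuous functions are integrals of their derivatives *)

Section AbsolutelyContinuousVariation.
Variable R : realType.
Implicit Types (a b d e x : R) (f F : R -> R) (p q : R * R) (l : seq (R * R)).

Definition ivl_in a b p := [&& a <= p.1, p.1 < p.2 & p.2 <= b].

Definition ivl_disj p q := (p.2 <= q.1) || (q.2 <= p.1).

Definition ivl_family a b l := all (ivl_in a b) l && pairwise ivl_disj l.

(* The intervals of a family come in no particular order, unlike in
   [abs_cont_on]: this makes refining an interval a mere concatenation. *)
Definition ac_mod a b f e d := forall l, ivl_family a b l ->
  \sum_(p <- l) (p.2 - p.1) < d -> \sum_(p <- l) `|f p.2 - f p.1| <= e.

Lemma ivl_disjC p q : ivl_disj p q = ivl_disj q p.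
Proof. by rewrite /ivl_disj orbC. Qed.

(** Inserts [p] between the intervals ending before it and those starting after it; disjointness
    leaves no others. This recovers the ordered families of [abs_cont_on]. *)
Lemma ivl_family_sort a b l : ivl_family a b l ->
  exists2 l', perm_eq l l' & pairwise (fun p q => p.2 <= q.1) l'.
Proof.
rewrite /ivl_family; elim: l => [_|p l IH /=]; first by exists [::].
move=> /andP[/andP[pab lab] /andP[pl ll]].
have [|l' ll' l's] := IH; first by rewrite lab.
have pl' q : q \in l' -> ivl_disj p q.
  by rewrite -(perm_mem ll') => ql; exact: (allP pl).
have lab' q : q \in l' -> ivl_in a b q.
  by rewrite -(perm_mem ll') => ql; exact: (allP lab).
have lt q : q \in l' -> predC (fun q => q.2 <= p.1) q = (p.2 <= q.1).
  move=> ql /=; have /orP := pl' q ql; have /and3P[_ q12 _] := lab' q ql.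
  have /and3P[_ p12 _] := pab.
  by move=> -[] h; [rewrite h leNgt negbK|rewrite h leNgt]; apply/esym; lra.
exists ([seq q <- l' | q.2 <= p.1] ++ p :: [seq q <- l' | predC (fun q => q.2 <= p.1) q]).
  rewrite (@perm_trans _ (p :: l'))// ?perm_cons//.
  by rewrite perm_sym perm_catC/= perm_cons perm_catC perm_filterC.
rewrite pairwise_cat/= !(subseq_pairwise (filter_subseq _ _) l's)/= andbT.
have lo : all (fun q => q.2 <= p.1) [seq q <- l' | q.2 <= p.1].
  by apply/allP => q; rewrite mem_filter => /andP[].
have hi : all (fun q => p.2 <= q.1) [seq q <- l' | predC (fun q => q.2 <= p.1) q].
  by apply/allP => q; rewrite mem_filter => /andP[+ ql]; rewrite lt.
rewrite hi andbT; apply/allrelP => q r /(allP lo) q2; rewrite inE.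
move=> /predU1P[->//|/(allP hi) p2]; have /and3P[_ p12 _] := pab.
by rewrite (le_trans q2)// (le_trans (ltW p12)).
Qed.

Lemma abs_cont_mod a b f e : abs_cont_on a b f -> 0 < e ->
  exists2 d, 0 < d & ac_mod a b f e d.
Proof.
move=> acf e0; have [d d0 H] := acf e e0; exists d => // l lab.
have [l' ll' l's] := ivl_family_sort lab.
have lab' q : q \in l' -> ivl_in a b q.
  rewrite -(perm_mem ll') => ql; move: lab => /andP[+ _].
  by move=> /allP; exact.
rewrite !(perm_big _ ll')/= !(big_nth (0, 0)) !big_mkord => ld.
apply/ltW/(H (size l') (fun i => (nth (0, 0) l' i).1) (fun i => (nth (0, 0) l' i).2)) => //.
- move=> i il; have /and3P[? ? ?] := lab' _ (mem_nth (0, 0) il).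
  by split => //; split => //; exact: ltW.
- move=> i j ij jl; have /(pairwiseP (0, 0)) := l's; apply => //=.
  exact: ltn_trans ij jl.
Qed.

Lemma sum_zip_swap (G : R -> R -> R) a (s : seq R) :
  \sum_(p <- zip s (a :: s)) G p.1 p.2 = \sum_(p <- zip (a :: s) s) G p.2 p.1.
Proof.
elim: s a => [|c s IH] a; first by rewrite !big_nil.
by rewrite /= !big_cons/= IH.
Qed.

Lemma zip_ivl_family a b s : itv_partition a b s ->
  ivl_family a b (zip (a :: s) s) /\
  \sum_(p <- zip (a :: s) s) (p.2 - p.1) = b - a.
Proof.
elim: s a => [|c s IH] a.
  by move=> /itv_partition_nil ->; rewrite big_nil subrr.
move=> abs; have cbs := itv_partition_cons abs.
have ac : a < c by have [/= /andP[]] := abs.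
have cb := itv_partition_le cbs.
have [/andP[cs cs'] sumcs] := IH c cbs.
rewrite [zip _ _]/= big_cons sumcs/=; split; last by ring.
rewrite /ivl_family/= cs' andbT {1}/ivl_in/= lexx ac cb/=; apply/andP; split.
  by apply: sub_all cs => p /and3P[cp p12 pb]; rewrite /ivl_in p12 pb (le_trans (ltW ac)).
by apply: sub_all cs => p /and3P[cp _ _]; rewrite /ivl_disj/= cp.
Qed.

(** The modulus of [f] also serves for its variation: each interval is replaced by an arbitrary
    partition of itself, which preserves the total length, and then the supremum is taken. *)
Lemma ac_mod_total_variation a b f e d : ac_mod a b f e d ->
  forall l, ivl_family a b l -> \sum_(p <- l) (p.2 - p.1) < d ->
  (\sum_(p <- l) total_variation p.1 p.2 f <= e%:E)%E.
Proof.
move=> acf.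
(* The induction needs two lists: the intervals of [l] are still to be refined, those of [l0]
   already count by their increments. *)
suff H l l0 : ivl_family a b (l ++ l0) ->
    \sum_(p <- l ++ l0) (p.2 - p.1) < d ->
    (\sum_(p <- l) total_variation p.1 p.2 f
     + (\sum_(p <- l0) `|f p.2 - f p.1|)%:E <= e%:E)%E.
  by move=> l lab ld; have := H l [::]; rewrite cats0 big_nil adde0; exact.
elim: l l0 => [|p l IH] l0 fam ld.
  by rewrite big_nil add0e lee_fin; exact: acf.
move: fam ld; rewrite cat_cons big_cons/=.
move=> /andP[/= /andP[pab lab] /andP[pl ll]] ld.
have /and3P[ap p12 pb] := pab.
rewrite big_cons -addeA; set B := (X in (_ + X)%E).
have Be : (B <= e%:E)%E.
  apply: IH; first by rewrite /ivl_family lab.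
  by rewrite (le_lt_trans _ ld)// lerDr subr_ge0 ltW.
(* Finiteness of [B] allows moving it across the inequality, so that the supremum over partitions of
   [p] is bounded partition by partition. *)
have Bfin : B \is a fin_num.
  rewrite fin_real// (le_lt_trans Be) ?ltry// andbT (@lt_le_trans _ _ 0%E)//.
  rewrite adde_ge0//; last by rewrite lee_fin sumr_ge0.
  rewrite big_seq_cond sume_ge0// => q; rewrite andbT => ql.
  apply: total_variation_ge0.
  have /and3P[_ /ltW//] : ivl_in a b q.
  by move: lab => /allP; apply; rewrite mem_cat ql.
rewrite -leeBrDr//; apply: ge_ereal_sup => _ [_ [s ps <-] <-].
rewrite leeBrDr// /B addeCA -EFinD variation_zip//.
rewrite (sum_zip_swap (fun u v => `|f u - f v|)).
set Z := zip (p.1 :: s) s; rewrite -[(\sum_(_ <- Z) _) + _]big_cat/=.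
have [/andP[Zp Zd] Zsum] := zip_ivl_family ps.
have Zdisj q z : z \in Z -> ivl_disj p q -> ivl_disj z q.
  move=> /(allP Zp) /and3P[pz z12 zp] /orP[pq|qp].
    by rewrite /ivl_disj (le_trans zp).
  by rewrite /ivl_disj (le_trans qp)// orbT.
apply: IH; last first.
  move: ld; rewrite !big_cat/= Zsum; lra.
move: lab ll pl; rewrite /ivl_family !all_cat !pairwise_cat.
move=> /andP[-> ->] /and3P[ll0 -> ->] /andP[pl pl0]; rewrite Zd/= !andbT.
apply/and3P; split.
- apply: sub_all Zp => z /and3P[pz z12 zp].
  by rewrite /ivl_in z12 (le_trans ap)// (le_trans zp).
- rewrite allrel_catr ll0 andbT; apply/allrelP => q z ql zZ.
  by rewrite ivl_disjC Zdisj//; exact: (allP pl).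
- by apply/allrelP => z q zZ ql0; rewrite Zdisj//; exact: (allP pl0).
Qed.

End AbsolutelyContinuousVariation.

(** * Jordan decomposition within absolutely continuous functions *)

Section AbsolutelyContinuousDecomposition.
Variable R : realType.
Implicit Types (a b d e x : R) (f F : R -> R) (p q : R * R) (l : seq (R * R)).

Definition ac_seq a b f :=
  forall e, 0 < e -> exists2 d, 0 < d & ac_mod a b f e d.

Lemma ac_seqD a b f g : ac_seq a b f -> ac_seq a b g -> ac_seq a b (f \+ g).
Proof.
move=> acf acg e e0; have e20 : 0 < e / 2 by rewrite divr_gt0.
have [d1 d10 H1] := acf _ e20; have [d2 d20 H2] := acg _ e20.
exists (Num.min d1 d2) => [|l fl]; first by rewrite lt_min d10.
rewrite lt_min => /andP[/(H1 _ fl) s1 /(H2 _ fl) s2].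
rewrite (splitr e); apply: le_trans (lerD s1 s2); rewrite -big_split/=.
by apply: ler_sum => p _; rewrite opprD addrACA ler_normD.
Qed.

Lemma ac_seqN a b f : ac_seq a b f -> ac_seq a b (\- f).
Proof.
move=> acf e e0; have [d d0 H] := acf e e0; exists d => // l fl /(H _ fl).
by apply: le_trans; apply: ler_sum => p _; rewrite -opprD normrN.
Qed.

Lemma ac_seq_lt a b f u v e d : ac_mod a b f e d -> a <= u -> u <= v -> v <= b ->
  0 <= e -> v - u < d -> (total_variation u v f <= e%:E)%E.
Proof.
move=> H au; rewrite le_eqVlt => /predU1P[->|uv] vb e0 vud.
  by rewrite total_variationxx lee_fin.
have := @ac_mod_total_variation _ _ _ _ _ _ H [:: (u, v)].
by rewrite !big_seq1/=; apply => //; rewrite /ivl_family/= /ivl_in/= au uv vb.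
Qed.

(** Pieces shorter than the [d] belonging to [1] have variation at most [1] each, and variation is
    additive. *)
Lemma ac_total_variation_fin a b f : a <= b -> ac_seq a b f ->
  total_variation a b f \is a fin_num.
Proof.
move=> ab acf; have [d d0 H] := acf 1 ltr01.
pose n := (Num.truncn ((b - a) / d)).+1.
have n0 : (0 : R) < n%:R by rewrite ltr0n.
pose h := (b - a) / n%:R.
have h0 : 0 <= h by rewrite divr_ge0 ?subr_ge0// ltW.
have hd : h < d.
  by rewrite /h ltr_pdivrMr// mulrC -ltr_pdivrMr// truncnS_gt.
have hn : a + n%:R * h = b by rewrite /h mulrCA divff ?mulr1 ?subrKC// gt_eqF.
have kb k : (k <= n)%N -> a + k%:R * h <= b.
  by move=> kn; rewrite -[leRHS]hn lerD2l ler_wpM2r// ler_nat.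
have TVk k : (k <= n)%N -> (total_variation a (a + k%:R * h) f <= k%:R%:E)%E.
  elim: k => [_|k IH kn]; first by rewrite mul0r addr0 total_variationxx.
  have ak : a <= a + k%:R * h by rewrite lerDl mulr_ge0.
  have kk : a + k%:R * h <= a + k.+1%:R * h.
    by rewrite lerD2l ler_wpM2r// ler_nat.
  rewrite (total_variationD _ ak kk) -natr1 EFinD leeD ?IH// ?(ltnW kn)//.
  move: kk (kb _ kn); rewrite -natr1 => kk kb1.
  by apply: (ac_seq_lt H) => //; lra.
rewrite fin_real//; have := TVk n (leqnn n); rewrite hn => TVn.
by rewrite (le_lt_trans TVn) ?ltry// andbT (@lt_le_trans _ _ 0%E)// total_variation_ge0.
Qed.

(** With [T] the variation function, [f] is [T] minus [T - f]; [T] inherits absolute continuity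
    through [ac_mod_total_variation]. *)
Lemma ac_seq_nondecreasing_decomposition a b f : a <= b -> ac_seq a b f ->
  exists F1 F2, [/\ {in `[a, b] &, {homo F1 : u v / u <= v}},
    {in `[a, b] &, {homo F2 : u v / u <= v}}, ac_seq a b F1, ac_seq a b F2 &
    f = F1 \- F2].
Proof.
move=> ab acf.
pose T u := fine (total_variation a u f).
have fin := ac_total_variation_fin ab acf.
have finau u : a <= u <= b -> total_variation a u f \is a fin_num.
  move=> /andP[au ub]; move: fin; rewrite (total_variationD _ au ub).
  by rewrite fin_numD => /andP[].
have TE u v : a <= u -> u <= v -> v <= b ->
    total_variation u v f = (T v - T u)%:E.
  move=> au uv vb.
  have auf : total_variation a u f \is a fin_num.
    by rewrite finau// au (le_trans uv).
  have avf : total_variation a v f \is a fin_num.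
    by rewrite finau// vb (le_trans au).
  rewrite EFinB !fineK//; move: avf.
  rewrite (total_variationD _ au uv) fin_numD => /andP[_ uvf].
  by rewrite addeAC subee// add0e.
have fT u v : a <= u -> u <= v -> v <= b -> `|f v - f u| <= T v - T u.
  by move=> au uv vb; rewrite -lee_fin -TE// total_variation_ge.
have acT : ac_seq a b T.
  move=> e e0; have [d d0 H] := acf e e0; exists d => // l fl ld.
  rewrite -lee_fin (le_trans _ (ac_mod_total_variation H fl ld))//.
  rewrite -sumEFin !big_seq; apply: lee_sum => p pl.
  have /andP[/allP/(_ p pl)/and3P[ap /ltW p12 pb] _] := fl.
  rewrite TE// lee_fin ger0_norm//.
  exact: le_trans (fT _ _ ap p12 pb).
exists T, (T \- f); split => //.
- move=> u v; rewrite !in_itv/= => /andP[au _] /andP[_ vb] uv.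
  by rewrite -subr_ge0 (le_trans _ (fT _ _ au uv vb)).
- move=> u v; rewrite !in_itv/= => /andP[au _] /andP[_ vb] uv.
  by have := fT u v au uv vb; rewrite ler_norml => /andP[_]; lra.
- exact: ac_seqD acT (ac_seqN acf).
- by apply/funext => u /=; ring.
Qed.

End AbsolutelyContinuousDecomposition.

(** * Null sets of Stieltjes measures of absolutely continuous functions *)

Section StieltjesDensity.
Variable R : realType.
Implicit Types (a b d e u v : R) (F : R -> R).

(** Openness keeps [inf I] and [sup I] out of [I], so the hull [Rhull] has open ends. *)
Lemma open_interval_itvoo (I : set R) a b : open I -> is_interval I -> I !=set0 ->
  I `<=` `]a, b[ -> exists u v, [/\ a <= u, u < v, v <= b & I = `]u, v[%classic].
Proof.
move=> oI iI [c Ic] Iab.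
have lbI : has_lbound I by exists a => z /Iab; rewrite /= in_itv/= => /andP[/ltW].
have ubI : has_ubound I by exists b => z /Iab; rewrite /= in_itv/= => /andP[_ /ltW].
have ball z : I z -> exists2 e, 0 < e & I (z - e) /\ I (z + e).
  move=> Iz; have /nbhs_ballP[e /= e0 be] : nbhs z I by exact: open_nbhs_nbhs.
  have e20 : 0 < e / 2 by rewrite divr_gt0.
  have lte : e / 2 < e by rewrite gtr_pMr// invf_lt1// ltr1n.
  exists (e / 2) => //; split; apply: be; rewrite /ball/=.
    by rewrite opprB addrC subrK gtr0_norm.
  by rewrite opprD addNKr normrN gtr0_norm.
have ninf : ~ I (inf I).
  move=> /ball[e e0 [/(ge_inf lbI)]]; lra.
have nsup : ~ I (sup I).
  move=> /ball[e e0 [_ /(ub_le_sup ubI)]]; lra.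
have IE : I = `]inf I, sup I[%classic.
  move/is_intervalP : iI => {1}->; rewrite /Rhull.
  by rewrite (asboolT lbI) (asboolT ubI) (asboolF ninf) (asboolF nsup).
exists (inf I), (sup I); split => //.
- by apply: lb_le_inf => [|z /Iab]; [exists c|rewrite /= in_itv/= => /andP[/ltW]].
- by move: Ic; rewrite [in X in X -> _]IE/= in_itv/= => /andP[]; exact: lt_trans.
- by apply: ge_sup => [|z /Iab]; [exists c|rewrite /= in_itv/= => /andP[_ /ltW]].
Qed.

Lemma disjoint_itvoo u v u' v' : u < v -> u' < v' ->
  `]u, v[%classic `&` `]u', v'[%classic = set0 -> v <= u' \/ v' <= u.
Proof.
move=> uv uv' dis; have [|vu'] := leP v u'; first by left.
have [|v'u] := leP v' u; first by right.
have : (set0 : set R) ((Num.max u u' + Num.min v v') / 2).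
  have : Num.max u u' < Num.min v v' by rewrite gt_max !lt_min uv uv' v'u vu'.
  move=> mm; have := midf_lt mm; set m := (_ + _) / 2 => -[m1 m2].
  rewrite -dis /= !in_itv/=; move: m1 m2; rewrite gt_max lt_min.
  by move=> /andP[-> ->] /andP[-> ->].
by [].
Qed.

Section Clamp.
Variables (a b : R) (F : R -> R).
Hypothesis ab : a <= b.

(** Composition with [clamp] extends a function on [[a, b]] by constants to the whole line, as a
    cumulative function requires, without adding mass outside. *)
Definition clamp u := Num.max a (Num.min u b).

Lemma clamp_itv u : clamp u \in `[a, b].
Proof. by rewrite in_itv/= /clamp le_max lexx/= ge_max ab ge_min lexx orbT. Qed.

Lemma clamp_id u : a <= u <= b -> clamp u = u.
Proof. by move=> /andP[au ub]; rewrite /clamp min_l// max_r. Qed.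

Lemma clamp_nd u v : u <= v -> clamp u <= clamp v.
Proof.
move=> uv; rewrite /clamp ge_max !le_max lexx/=; apply/orP; right.
by rewrite le_min !ge_min uv lexx orbT.
Qed.

Lemma clamp_dist u v : u <= v -> clamp v - clamp u <= v - u.
Proof.
rewrite /clamp !maxEle !minEle => uv.
by repeat case: ifPn; rewrite -?ltNge => *; lra.
Qed.

End Clamp.

Section NullSets.
Variables (a b : R) (F : R -> R) (mu : {measure set (measurableTypeR R) -> \bar R}).
Hypothesis ab : a <= b.
Hypothesis acF : ac_seq a b F.
Hypothesis muE : forall u v, u <= v ->
  mu `]u, v]%classic = (F (clamp a b v) - F (clamp a b u))%:E.

(** [N] lies in an open set of length below [d], a disjoint union of intervals; absolute continuity
    bounds the increments of [F] over any finitely many of them by [e]. *)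
Lemma stieltjes_null (N : set R) : measurable N -> N `<=` `]a, b]%classic ->
  lebesgue_measure N = 0%E -> mu N = 0%E.
Proof.
move=> mN Nab N0; apply/eqP; rewrite eq_le measure_ge0 andbT.
apply/lee_addgt0Pr => e e0; rewrite add0e.
have [d d0 Hd] := acF e0.
have Noo : (lebesgue_measure N < +oo)%E by rewrite N0 ltry.
have [U [oU NU Ud]] := @lebesgue_regularity_outer R N d mN Noo d0.
(* The right end exceeds [b] because [N] may contain [b]; [mu] has no mass on []b, b + 1[]. *)
pose V := U `&` `]a, b + 1[%classic.
have oV : open V by apply: openI => //; exact: interval_open.
have mV : measurable V by exact: open_measurable.
have mU : measurable U by exact: open_measurable.
have NV : N `<=` V.
  move=> z Nz; split; first exact: NU.
  by have := Nab _ Nz; rewrite /= !in_itv/= => /andP[-> ?]/=; lra.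
have Vd : (lebesgue_measure V < d%:E)%E.
  apply: (le_lt_trans _ Ud).
  have mUN : measurable (U `\` N) by exact: measurableD.
  rewrite -[leRHS](@measureU0 _ _ _ lebesgue_measure (U `\` N) N)//.
  apply: le_measure; rewrite ?inE//; first exact: measurableU.
  by move=> z [Uz _]; have [Nz|Nz] := pselect (N z); [right|left].
pose I := open_disjoint_itv oV.
have VI : V = \bigcup_k I k := open_disjoint_itv_bigcup oV.
have tI : trivIset setT I by exact: open_disjoint_itv_trivIset.
have mI k : measurable (I k).
  by apply: open_measurable; exact: open_disjoint_itv_open.
have /choice[p pP] k : exists p : R * R,
    [/\ a <= p.1, p.1 <= p.2 & I k = `]p.1, p.2[%classic].
  have [I0|/set0P I0] := eqVneq (I k) set0.
    by exists (a, a); split => //=; rewrite I0 set_itvoo0.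
  have [||||u [v [au uv _ Iuv]]] := @open_interval_itvoo (I k) a (b + 1) => //.
  - exact: open_disjoint_itv_open.
  - exact: open_disjoint_itv_is_interval.
  - move=> z Iz; suff [] : V z by [].
    by rewrite VI; exists k.
  - by exists (u, v); split => //; exact: ltW.
have muI k : (mu (I k) <= (F (clamp a b (p k).2) - F (clamp a b (p k).1))%:E)%E.
  have [ap p12 IE] := pP k; rewrite -muE// IE; apply: le_measure.
  - by rewrite inE; exact: measurable_itv.
  - by rewrite inE; exact: measurable_itv.
  - by apply: subset_itvl; rewrite bnd_simp.
apply: (@le_trans _ _ (mu V)); first by apply: le_measure; rewrite ?inE.
rewrite VI (@measure_bigcup _ _ _ mu setT I (fun k _ => mI k) tI).
apply: lime_le; first exact: is_cvg_nneseries.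
near=> n.
(* Absolute continuity concerns intervals inside [[a, b]] only: components are cut at [b], and those
   that become empty are left out of [s]. *)
pose q k := ((p k).1, Num.min (p k).2 b).
pose s := [seq k <- index_iota 0 n | (q k).1 < (q k).2].
have qs k : k \in s -> (q k).1 < (q k).2 by rewrite mem_filter => /andP[].
have fam : ivl_family a b [seq q k | k <- s].
  rewrite /ivl_family; apply/andP; split.
    apply/allP => _ /mapP[k ks ->]; rewrite /ivl_in qs//=.
    by have [-> _ _] := pP k; rewrite /= ge_min lexx orbT.
  rewrite pairwise_map.
  have : pairwise (fun j k => j != k) s.
    by rewrite -uniq_pairwise filter_uniq// iota_uniq.
  apply: (@sub_in_pairwise _ (mem s)); last by apply/allP.
  move=> j k js ks jk /=.
  have [_ _ Ij] := pP j; have [_ _ Ik] := pP k.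
  have pj : (p j).1 < (p j).2 by have := qs _ js; rewrite /= lt_min => /andP[].
  have pk : (p k).1 < (p k).2 by have := qs _ ks; rewrite /= lt_min => /andP[].
  move/trivIsetP : tI => /(_ j k Logic.I Logic.I jk); rewrite Ij Ik.
  move=> /(disjoint_itvoo pj pk)[h|h]; apply/orP; [left|right] => /=.
    by rewrite ge_min h.
  by rewrite ge_min h.
have slen : \sum_(r <- [seq q k | k <- s]) (r.2 - r.1) < d.
  rewrite -lte_fin (le_lt_trans _ Vd)// big_map big_filter/=.
  rewrite VI (@measure_bigcup _ _ _ lebesgue_measure setT I (fun k _ => mI k) tI).
  apply: (le_trans _ (@nneseries_lim_ge _ _ _ 0%N n _)) => //.
  rewrite -sumEFin big_mkcond [leRHS]big_mkcond/=; apply: lee_sum => k _.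
  rewrite in_setT; case: ifPn => // _; have [_ p12 ->] := pP k.
  rewrite lebesgue_measure_itv/= lte_fin; case: ifPn => [_|].
    by rewrite -EFinD lee_fin lerD2r ge_min lexx.
  by rewrite -leNgt => p21; rewrite lee_fin subr_le0 ge_min p21.
have := Hd _ fam slen; rewrite -lee_fin; apply: le_trans.
rewrite big_map big_filter/= -sumEFin big_mkcond [leRHS]big_mkcond/=.
apply: lee_sum => k _; rewrite in_setT; have [ap p12 _] := pP k.
apply: (le_trans (muI k)).
case: ifPn => [|].
  rewrite lt_min => /andP[pk pb]; rewrite lee_fin.
  rewrite (@clamp_id a b (p k).1); last by rewrite ap ltW.
  have -> : clamp a b (p k).2 = Num.min (p k).2 b.
    by apply: max_r; rewrite le_min ab (le_trans ap).
  exact: ler_norm.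
rewrite -leNgt ge_min => /orP[p21|bp].
  have -> : (p k).2 = (p k).1 by apply/eqP; rewrite eq_le p21 p12.
  by rewrite subrr.
by rewrite /clamp !min_r ?subrr// (le_trans bp).
Unshelve. all: by end_near. Qed.

End NullSets.

End StieltjesDensity.

(** * Densities of absolutely continuous functions *)

Section AbsolutelyContinuousDensity.
Variable R : realType.
Implicit Types (a b d e u v : R) (f F : R -> R).

Lemma ac_mod_clamp a b F e d : a <= b -> 0 <= e -> ac_mod a b F e d ->
  forall u v, `|v - u| < d -> `|F (clamp a b v) - F (clamp a b u)| <= e.
Proof.
move=> ab e0 H u v; wlog uv : u v / u <= v => [hw|].
  by have [/hw//|/ltW/hw H'] := leP u v; rewrite distrC => /H'; rewrite distrC.
rewrite ger0_norm ?subr_ge0// => vud.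
have := clamp_nd a b uv; rewrite le_eqVlt => /predU1P[->|cuv].
  by rewrite subrr normr0.
have := H [:: (clamp a b u, clamp a b v)]; rewrite !big_seq1/=; apply.
  have := clamp_itv ab u; have := clamp_itv ab v; rewrite !in_itv/=.
  by rewrite /ivl_family/= /ivl_in/= cuv => /andP[_ ->] /andP[->].
exact: le_lt_trans (clamp_dist _ _ uv) vud.
Qed.

Lemma ac_seq_clamp_continuous a b F : a <= b -> ac_seq a b F ->
  continuous (F \o clamp a b).
Proof.
move=> ab acF z; apply/cvgrPdist_le => e e0.
have [d d0 H] := acF e e0; near=> t.
apply: (ac_mod_clamp ab (ltW e0) H); near: t.
by exists d.
Unshelve. all: by end_near. Qed.

(** Radon-Nikodym for the Lebesgue-Stieltjes measure of [F \o clamp a b], dominated by Lebesgue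
    measure thanks to [stieltjes_null]. *)
Lemma nondecreasing_ac_density a b F : a <= b ->
  {in `[a, b] &, {homo F : u v / u <= v}} -> ac_seq a b F ->
  exists2 g : R -> R, lebesgue_measure.-integrable setT (EFin \o g) &
    forall u, a <= u <= b ->
      (F u - F a)%:E = (\int[lebesgue_measure]_(t in `]a, u]) (g t)%:E)%E.
Proof.
move=> ab ndF acF; pose G := F \o clamp a b.
have ndG : nondecreasing G.
  by move=> u v uv; apply: ndF; rewrite ?clamp_itv//; exact: clamp_nd.
have rcG : right_continuous G.
  by apply: right_continuousW; exact: ac_seq_clamp_continuous.
pose Gc : cumulative R R := HB.pack G (isCumulative.Build R _ R G ndG rcG).
pose mu := lebesgue_stieltjes_measure Gc.
have muE u v : u <= v -> mu `]u, v]%classic = (F (clamp a b v) - F (clamp a b u))%:E.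
  move=> uv; rewrite /mu /lebesgue_stieltjes_measure /measure_extension.
  rewrite measurable_mu_extE; last exact: is_ocitv.
  exact: (wlength_itv_bnd G).
have mD : measurable (`]a, b]%classic : set (measurableTypeR R)).
  exact: measurable_itv.
have muoo : (mu `]a, b]%classic < +oo)%E by rewrite muE// ltry.
(* Restriction to []a, b]] yields a finite measure and confines null sets to where [stieltjes_null]
   applies. *)
pose nu : {finite_measure set (measurableTypeR R) -> \bar R} := mfrestr mD muoo.
have numu : nu `<< (@lebesgue_measure R).
  apply/null_content_dominatesP => N mN N0; rewrite /nu/= /mfrestr/= /mrestr.
  apply: (stieltjes_null ab acF muE).
  - exact: measurableI.
  - exact: subIsetr.
  - apply/eqP; rewrite eq_le measure_ge0 andbT -N0; apply: le_measure.
    + by rewrite inE; exact: measurableI.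
    + by rewrite inE.
    + exact: subIsetl.
have [g [g0 gfin gint gE]] := @radon_nikodym_sigma_finite _ _ _
  (@lebesgue_measure R) nu numu.
exists (fine \o g).
  by apply: eq_integrable gint => // z _; rewrite /= fineK.
move=> u /andP[au ub].
have -> : (F u - F a)%:E = nu `]a, u]%classic.
  rewrite -[nu _]/(mu (`]a, u]%classic `&` `]a, b]%classic)).
  rewrite setIidl; last by apply: subset_itvl; rewrite bnd_simp.
  by rewrite muE// !clamp_id ?au ?lexx ?ab.
rewrite gE; last exact: measurable_itv.
by apply: eq_integral => z _; rewrite /= fineK.
Qed.

Lemma ac_density a b f : a <= b -> ac_seq a b f ->
  exists2 g : R -> R, lebesgue_measure.-integrable setT (EFin \o g) &
    forall u, a <= u <= b ->
      f u - f a = \int[lebesgue_measure]_(t in `]a, u]) (g t).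
Proof.
move=> ab acf.
have [F1 [F2 [nd1 nd2 ac1 ac2 ->]]] := ac_seq_nondecreasing_decomposition ab acf.
have [g1 int1 E1] := nondecreasing_ac_density ab nd1 ac1.
have [g2 int2 E2] := nondecreasing_ac_density ab nd2 ac2.
exists (g1 \- g2).
  by have := integrableB measurableT int1 int2; apply: eq_integrable.
move=> u uab; rewrite RintegralB//.
- by rewrite /Rintegral -E1// -E2//=; lra.
- by apply: integrableS int1 => //; exact: measurable_itv.
- by apply: integrableS int2 => //; exact: measurable_itv.
Qed.

End AbsolutelyContinuousDensity.

(** * Energy inequality on subintervals *)

Section Energy.
Variable R : realType.
Implicit Types (a b d e u v x : R) (f F : R -> R).

(* The larger function may fail to be measurable: its integral is still the
   supremum of the integrals of the simple functions below it. *)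
Lemma ge0_le_integral_nonmeasurable (disp : measure_display) (T : measurableType disp)
    (mu : {measure set T -> \bar R}) (D : set T) (g h : T -> \bar R) :
  (forall t, D t -> (0 <= g t)%E) -> (forall t, D t -> (g t <= h t)%E) ->
  (\int[mu]_(t in D) g t <= \int[mu]_(t in D) h t)%E.
Proof.
move=> g0 gh; rewrite !ge0_integralE//; last first.
  by move=> t Dt; rewrite (le_trans (g0 t Dt))// gh.
apply: ereal_sup_le => _ [k kg <-]; exists k => //= t.
rewrite (le_trans (kg t))// /patch; case: ifPn => // /set_mem; exact: gh.
Qed.

(** Setting [g] to zero on the exceptional null set keeps its integral and makes the comparison hold
    everywhere, as the previous lemma requires. *)
Lemma ae_ge0_le_integral_nonmeasurable (disp : measure_display) (T : measurableType disp)
    (mu : {measure set T -> \bar R}) (D : set T) (g h : T -> \bar R) :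
  measurable D -> measurable_fun D g ->
  (forall t, D t -> (0 <= g t)%E) -> (forall t, D t -> (0 <= h t)%E) ->
  {ae mu, forall t, D t -> (g t <= h t)%E} ->
  (\int[mu]_(t in D) g t <= \int[mu]_(t in D) h t)%E.
Proof.
move=> mD mg g0 h0 [N [mN N0 subN]].
pose k := g \_ (~` N).
have k0 t : D t -> (0 <= k t)%E.
  by move=> Dt; rewrite /k /patch; case: ifPn => // _; exact: g0.
rewrite (@ge0_ae_eq_integral _ _ _ _ _ g k)//.
- apply: ge0_le_integral_nonmeasurable => // t Dt.
  rewrite /k /patch; case: ifPn => [/set_mem Nt|_]; last exact: h0.
  apply: contrapT => gh; apply: Nt; apply: subN => /= H; apply: gh; exact: H.
- rewrite /k; apply/measurable_restrict => //; first exact: measurableC.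
  by apply: measurable_funS mg => //; exact: subIsetl.
- exists N; split => // t /= /not_implyP[Dt gk].
  apply: contrapT => Nt; apply: gk; rewrite /k /patch ifT//.
  by apply/mem_set.
Qed.

(** Lebesgue differentiation of the indefinite integral [F] of [g]; near an interior point [f] is
    [F] plus the constant [f 0]. *)
Lemma ac_derive1_ae x f (g : R -> R) : lebesgue_measure.-integrable setT (EFin \o g) ->
  (forall u, 0 <= u <= x -> f u - f 0 = \int[lebesgue_measure]_(t in `]0, u]) (g t)) ->
  {ae lebesgue_measure, forall u, u \in `]0, x[ -> derive1 f u = g u}.
Proof.
move=> gint fE.
have gint0 y : lebesgue_measure.-integrable `]0, y] (EFin \o g).
  by apply: integrableS gint.
have := @FTC1 R g (BRight 0) gint0 (open_integrable_locally openT gint).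
apply: filterS; first exact: (ae_filter_ringOfSetsType lebesgue_measure).
move=> u H; rewrite in_itv/= => /andP[u0 ux].
have [|dF <-] := H; first by rewrite /= lte_fin.
rewrite !derive1E; set F := fun y => _ in dF *.
have dFc : is_derive u 1 (F + cst (f 0)) ('D_1 F u).
  have := is_deriveD (derivableP dF) (is_derive_cst (f 0) u 1).
  by rewrite addr0.
rewrite -(@derive_val _ _ _ _ _ _ _ dFc); apply: near_eq_derive; near=> y; rewrite fctE /F -fE; first by rewrite subrK.
apply/andP; split; near: y.
  by apply: filterS (lt_nbhsr u0) => z /ltW.
by apply: filterS (lt_nbhsl ux) => z /ltW.
Unshelve. all: by end_near. Qed.

(** [e u] is the integral of $g^2$ over []0, u]], where [g] is the density of [f]. Every later use
    of the bound on [Gamma x f] passes through [e]. *)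
Lemma ac_energy x (gamma : R) f : 0 < x -> abs_cont_on 0 x f ->
  (Gamma x f <= gamma%:E)%E ->
  exists e : R -> R, [/\ e 0 = 0, e x <= gamma &
    forall u v, 0 <= u -> u <= v -> v <= x ->
      e u <= e v /\ (f v - f u) ^+ 2 <= (v - u) * (e v - e u)].
Proof.
move=> x0 acf Gg.
have acf' : ac_seq 0 x f by move=> e e0; exact: abs_cont_mod.
have [g gint fE] := ac_density (ltW x0) acf'.
have gae := ac_derive1_ae gint fE.
have mg : measurable_fun setT g by move/integrableP : gint => [/measurable_EFinP].
have mg2 : measurable_fun setT (fun t => (g t) ^+ 2) by apply: measurable_funX.
have g2le : (\int[lebesgue_measure]_(t in `]0%R, x[) ((g t) ^+ 2)%:E <= gamma%:E)%E.
  apply: le_trans Gg; rewrite /Gamma.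
  (* The comparison with [g] is made on the open interval: at the end points [derive1 f] sees values
     of [f] outside [[0, x]]. *)
  apply: (@le_trans _ _ (\int[lebesgue_measure]_(t in `]0%R, x[) ((derive1 f t) ^+ 2)%:E)%E).
    apply: ae_ge0_le_integral_nonmeasurable => //.
    - by apply/measurable_EFinP; apply: measurable_funS mg2.
    - by move=> t _; rewrite lee_fin sqr_ge0.
    - by move=> t _; rewrite lee_fin sqr_ge0.
    - by apply: filterS gae; [exact: (ae_filter_ringOfSetsType lebesgue_measure)|move=> t H /H ->].
  rewrite [leLHS]integral_mkcond [leRHS]integral_mkcond.
  apply: ge0_le_integral_nonmeasurable => t _; rewrite /patch.
    by case: ifPn => // _; rewrite lee_fin sqr_ge0.
  case: ifPn => [/set_mem/= tx|_]; last first.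
    by case: ifPn => // _; rewrite lee_fin sqr_ge0.
  by rewrite mem_set//=; move: tx; rewrite !in_itv/= => /andP[/ltW -> /ltW ->].
have g2int : lebesgue_measure.-integrable `]0, x] (EFin \o (fun t => (g t) ^+ 2)).
  apply/integrableP; split.
    by apply/measurable_EFinP; apply: measurable_funS mg2.
  under eq_integral do rewrite /= ger0_norm ?sqr_ge0//.
  rewrite integral_itv_bndoo; last first.
    by apply/measurable_EFinP; apply: measurable_funS mg2.
  exact: le_lt_trans g2le (ltry _).
pose e u := \int[lebesgue_measure]_(t in `]0, u]) ((g t) ^+ 2).
exists e; split.
- by rewrite /e set_itvoc0 Rintegral_set0.
- rewrite -lee_fin /e /Rintegral fineK; last exact: integrable_fin_num.
  rewrite integral_itv_bndoo//.
  by apply/measurable_EFinP; apply: measurable_funS mg2.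
move=> u v u0 uv vx.
have sub2 : lebesgue_measure.-integrable `]0, v] (EFin \o (fun t => (g t) ^+ 2)).
  by apply: integrableS g2int => //; apply: subset_itvl; rewrite bnd_simp.
have evu : e v - e u = \int[lebesgue_measure]_(t in `]u, v]) ((g t) ^+ 2).
  by rewrite /e Rintegral_itvB// bnd_simp.
have e_le : 0 <= e v - e u by rewrite evu Rintegral_ge0// => t _; exact: sqr_ge0.
split; first by rewrite -subr_ge0.
move: uv; rewrite le_eqVlt => /predU1P[->|uv]; first by rewrite !subrr expr0n mul0r.
have uv0 : 0 < v - u by rewrite subr_gt0.
have uvint : lebesgue_measure.-integrable `]u, v] (EFin \o (fun t => (g t) ^+ 2)).
  by apply: integrableS sub2 => //; apply: subset_itvr; rewrite bnd_simp.
have fvu : f v - f u = \int[lebesgue_measure]_(t in `]u, v]) (g t).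
  rewrite -(@Rintegral_itvB _ g (BRight 0) (BRight v) u) ?bnd_simp//; last 2 first.
    by apply: integrableS gint.
    exact: ltW.
  by rewrite -!fE ?u0 ?vx ?(ltW (lt_le_trans uv vx)) ?(le_trans u0 (ltW uv))//; ring.
set c := f v - f u in fvu *; set k := c / (v - u).
have guv : lebesgue_measure.-integrable `]u, v] (EFin \o g).
  by apply: integrableS gint.
have cint (r : R) : lebesgue_measure.-integrable `]u, v] (EFin \o cst r).
  have : lebesgue_measure.-integrable `[u, v] (EFin \o cst r).
    apply: continuous_compact_integrable; first exact: segment_compact.
    by apply: continuous_subspaceT => z; exact: cst_continuous.
  by apply: integrableS => //; apply: subset_itvr; rewrite bnd_simp.
(* Cauchy-Schwarz by expanding $\int (g-k)^2 \ge 0$, where [k] is the mean slope of [f] from [u] to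
   [v]. *)
have : 0 <= \int[lebesgue_measure]_(t in `]u, v]) (((g t) ^+ 2 - (2 * k) * g t) + k ^+ 2).
  apply: Rintegral_ge0 => t _; rewrite (_ : _ + _ = (g t - k) ^+ 2) ?sqr_ge0//; ring.
have kgint : lebesgue_measure.-integrable `]u, v] (EFin \o (fun t => (2 * k) * g t)).
  exact: (integrableZl _ (2 * k) guv).
rewrite RintegralD//; last 2 first.
- exact: (integrableB _ uvint kgint).
- exact: cint.
rewrite RintegralB// RintegralZl// Rintegral_cst// -evu -fvu.
have lenE : fine (lebesgue_measure (`]u, v]%classic : set R)) = v - u.
  by rewrite lebesgue_measure_itv/= lte_fin uv.
rewrite [X in _ ^+ 2 * X]lenE.
have -> : e v - e u - 2 * k * c + k ^+ 2 * (v - u) = e v - e u - c ^+ 2 / (v - u).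
  by rewrite /k; field; rewrite gt_eqF.
by rewrite subr_ge0 ler_pdivrMr// mulrC.
Qed.

End Energy.

(** * Area of the hull and discrete hulls *)

Section HullArea.
Variable R : realType.
Implicit Types (f h : R -> R) (x u v w : R) (n i j k : nat).

(** The constant [B] is a concave majorant, so the infimum is taken over a nonempty set and not a
    default value. *)
Lemma lcmaj_ge x f B u : (forall v, 0 <= v <= x -> f v <= B) -> 0 <= u <= x ->
  f u <= lcmaj x f u.
Proof.
move=> fB u0x; apply: lb_le_inf; last by move=> _ [h [_ fh] <-]; exact: fh.
by exists B, (fun=> B) => //; split => // ? ? t _ _ _; lra.
Qed.

Lemma lcmaj_le x f h u : concave_on 0 x h -> (forall v, 0 <= v <= x -> f v <= h v) ->
  0 <= u <= x -> lcmaj x f u <= h u.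
Proof.
move=> ch fh u0x; apply: ge_inf; last by exists h.
by exists (f u) => _ [k [_ fk] <-]; exact: fk.
Qed.

Lemma gcminE x f u : gcmin x f u = - lcmaj x (\- f) u.
Proof.
rewrite /gcmin /lcmaj /inf opprK; congr sup; apply/seteqP; split => y /=.
- move=> [h [ch hf] <-]; exists (- h u); last by rewrite opprK.
  exists (\- h) => //; split=> [p q t pI qI tI|v vI] /=.
    by have := ch p q t pI qI tI; lra.
  by rewrite lerN2 hf.
- move=> [_ [h [ch hf] <-] <-]; exists (\- h) => //; split=> [p q t pI qI tI|v vI] /=.
    by have := ch p q t pI qI tI; lra.
  by rewrite lerNl hf.
Qed.

Lemma grid_cell (d : R) n u : (0 < n)%N -> 0 <= u -> u <= n%:R * d ->
  exists i, [/\ (i < n)%N, i%:R * d <= u & u <= i.+1%:R * d].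
Proof.
case: n => // n _ u0; elim: n => [|n IH] un; first by exists 0%N; rewrite mul0r.
have [/IH[i [i_n iu ui]]|nu] := leP u (n.+1%:R * d).
  by exists i; split => //; exact: leqW.
by exists n.+1; split => //; exact: ltW.
Qed.

Section Grid.
Variables (x : R) (n : nat) (f : R -> R) (w : R).
Hypotheses (x0 : 0 < x) (n0 : (0 < n)%N) (w0 : 0 <= w).

Local Notation d := (x / n%:R).
Local Notation gr f := (fun i : nat => f (i%:R * d)).

Hypothesis osc : forall i u, (i < n)%N -> i%:R * d <= u <= i.+1%:R * d ->
  `|f u - f (i%:R * d)| <= w /\ `|f u - f (i.+1%:R * d)| <= w.
Hypothesis energy : \sum_(i < n) (f (i.+1%:R * d) - f (i%:R * d)) ^+ 2 <= w ^+ 2.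

Lemma grid_step_gt0 : 0 < d.
Proof. by rewrite divr_gt0// ltr0n. Qed.

Lemma grid_endE : n%:R * d = x.
Proof. by rewrite mulrCA divff ?mulr1// pnatr_eq0 -lt0n. Qed.

(** By orthogonality the energy of [f] on the grid exceeds that of [M] by the energy of [M - f]. *)
Lemma seq_cmaj_step i : (i < n)%N ->
  `|seq_cmaj n (gr f) i.+1 - seq_cmaj n (gr f) i| <= w.
Proof.
move=> i_n; rewrite -[leRHS]ger0_norm// -ler_sqr ?nnegrE// !real_normK ?num_real//.
apply: le_trans energy; set M := seq_cmaj n _.
apply: (@le_trans _ _ (\sum_(k < n) (M k.+1 - M k) ^+ 2)).
  by rewrite (bigD1 (Ordinal i_n))//= lerDl sumr_ge0// => k _; exact: sqr_ge0.
have := seq_cmaj_orthogonal n (gr f); rewrite -/M /= => orth.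
rewrite -subr_ge0 -sumrB.
rewrite -[X in 0 <= X]addr0 -[X in _ + X](mulr0 2) -[X in _ + 2 * X]orth mulr_sumr -big_split/=.
apply: sumr_ge0 => k _.
rewrite [leRHS](_ : _ = ((M k.+1 - M k) - (f (k.+1%:R * d) - f (k%:R * d))) ^+ 2) ?sqr_ge0//.
by ring.
Qed.

(** The line through the discrete majorant at [i] and [i.+1], raised by [w], dominates [f] on all of
    [[0, x]], as [f] varies by at most [w] on a cell. The second [w] is the rise along the cell. *)
Lemma lcmaj_grid_le i u : (i < n)%N -> i%:R * d <= u <= i.+1%:R * d ->
  lcmaj x f u <= seq_cmaj n (gr f) i + 2 * w.
Proof.
move=> i_n /andP[iu ui]; have d0 := grid_step_gt0.
set M := seq_cmaj n _.
pose h v := M i + (v / d - i%:R) * (M i.+1 - M i) + w.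
have hle : h u <= M i + 2 * w.
  have step := seq_cmaj_step i_n; rewrite -/M in step.
  have : (u / d - i%:R) * (M i.+1 - M i) <= w.
    rewrite (le_trans (ler_norm _))// normrM -[leRHS]mul1r ler_pM//.
    rewrite ger0_norm ?subr_ge0 ?ler_pdivlMr//.
    by rewrite lerBlDr ler_pdivrMr// addrC natr1.
  by rewrite /h; lra.
apply: le_trans hle; apply: lcmaj_le.
- by move=> p q t _ _ _; rewrite /h le_eqVlt; apply/orP; left; apply/eqP; ring.
- move=> v /andP[v0 vx].
  have [|j [j_n jv vj]] := @grid_cell d n v n0 v0; first by rewrite grid_endE.
  have [|/ler_normlW h1 /ler_normlW h2] := osc j_n (u := v); first by rewrite jv.
  have tj := seq_concave_tangent (@seq_cmaj_concave _ n (gr f)) i_n (ltnW j_n).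
  have tj1 := seq_concave_tangent (@seq_cmaj_concave _ n (gr f)) i_n j_n.
  have fj := seq_cmaj_ge (gr f) (ltnW j_n); have fj1 := seq_cmaj_ge (gr f) j_n.
  rewrite -/M/= in tj tj1 fj fj1.
  pose t := v / d - j%:R.
  have t0 : 0 <= t by rewrite subr_ge0 ler_pdivlMr.
  have t1 : t <= 1 by rewrite lerBlDr ler_pdivrMr// addrC natr1.
  (* The affine [h] is interpolated between the ends of cell [j]; at both ends it is at least
     [f v]. *)
  have -> : h v = (1 - t) * (M i + (j%:R - i%:R) * (M i.+1 - M i))
      + t * (M i + (j.+1%:R - i%:R) * (M i.+1 - M i)) + w.
    by rewrite /h /t -[j.+1%:R]natr1; ring.
  have e1 : 0 <= (1 - t) * (M i + (j%:R - i%:R) * (M i.+1 - M i) - (f v - w)).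
    by rewrite mulr_ge0//; lra.
  have e2 : 0 <= t * (M i + (j.+1%:R - i%:R) * (M i.+1 - M i) - (f v - w)).
    by rewrite mulr_ge0//; lra.
  by lra.
- apply/andP; split; first by apply: le_trans iu; rewrite mulr_ge0// ltW.
  by apply: (le_trans ui); rewrite -[leRHS]grid_endE ler_wpM2r ?ler_nat// ltW.
Qed.

End Grid.

(** * Hull area against sums over the grid *)

Section AreaBound.
Variables (x : R) (n : nat) (f : R -> R) (w : R).
Hypotheses (x0 : 0 < x) (n0 : (0 < n)%N) (w0 : 0 <= w).

Local Notation d := (x / n%:R).
Local Notation gr f := (fun i : nat => f (i%:R * d)).

Hypothesis osc : forall i u, (i < n)%N -> i%:R * d <= u <= i.+1%:R * d ->
  `|f u - f (i%:R * d)| <= w /\ `|f u - f (i.+1%:R * d)| <= w.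
Hypothesis energy : \sum_(i < n) (f (i.+1%:R * d) - f (i%:R * d)) ^+ 2 <= w ^+ 2.

(** This is [lcmaj_grid_le] for [- f], which has the same oscillation and energy bounds. *)
Lemma gcmin_grid_ge i u : (i < n)%N -> i%:R * d <= u <= i.+1%:R * d ->
  seq_cmin n (gr f) i - 2 * w <= gcmin x f u.
Proof.
move=> i_n iu; rewrite gcminE /seq_cmin -opprD lerN2.
apply: (lcmaj_grid_le (f := \- f)) iu => //.
- move=> j v j_n jv; have [] := osc j_n jv; rewrite -(normrN (f v - f (j%:R * d))).
  rewrite -(normrN (f v - f (j.+1%:R * d))) /= => h1 h2.
  by rewrite -!opprD in h1 h2 *; split.
- by apply: le_trans energy; apply: ler_sum => k _; rewrite /= -opprD sqrrN.
Qed.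

(** On cell [i] the width of the hull is at most [c i], each of the two hulls contributing an error
    [2 * w]. *)
Lemma Area_grid_le : (Area x f <=
  (d * \sum_(i < n) (seq_cmaj n (gr f) i - seq_cmin n (gr f) i) + 4 * w * x)%:E)%E.
Proof.
have d0 := grid_step_gt0 x0 n0.
set M := seq_cmaj n _; set m := seq_cmin n _.
have MmD i : (i <= n)%N -> 0 <= M i - m i.
  move=> i_n; have := seq_cmaj_ge (gr f) i_n.
  have := seq_cmaj_ge (fun k => - gr f k) i_n; rewrite /M /m /seq_cmin/=; lra.
pose I i : set R := `[i%:R * d, i.+1%:R * d]%classic.
pose c i : R := M i - m i + 4 * w.
have c0 i : (i <= n)%N -> 0 <= c i by move=> i_n; rewrite addr_ge0 ?MmD// mulr_ge0.
(* The closed cells share end points, which can only enlarge [g] since the [c i] are nonnegative. *)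
pose g u : \bar R := (\sum_(i < n) (c i * \1_(I i) u)%:E)%E.
have bndD : exists B, forall v, 0 <= v <= x -> `|f v| <= B.
  exists (\sum_(i < n) `|f (i%:R * d)| + w) => v /andP[v0 vx].
  have [|j [j_n jv vj]] := @grid_cell d n v n0 v0; first by rewrite grid_endE.
  have [|h1 _] := osc j_n (u := v); first by rewrite jv.
  have := ler_normD (f v - f (j%:R * d)) (f (j%:R * d)); rewrite subrK.
  rewrite (bigD1 (Ordinal j_n))//=; set S := \sum_(_ < _ | _) _.
  have S0 : 0 <= S by rewrite sumr_ge0.
  by lra.
have [B fB] := bndD.
have hull u : 0 <= u <= x -> gcmin x f u <= f u <= lcmaj x f u.
  move=> ux; rewrite (@lcmaj_ge _ _ B)//; last first.
    by move=> v /fB; rewrite ler_norml => /andP[].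
  rewrite gcminE lerNl andbT (@lcmaj_ge _ (\- f) B)// => v /fB.
  by rewrite ler_norml lerNl => /andP[].
apply: (@le_trans _ _ (\int[lebesgue_measure]_(u in `[0%R, x]) g u)%E).
  apply: ge0_le_integral_nonmeasurable => u; rewrite /= in_itv/= => ux.
    by have /andP[h1 h2] := hull u ux; rewrite lee_fin subr_ge0 (le_trans h1).
  have [||j [j_n ju uj]] := @grid_cell d n u n0.
  - by case/andP: ux.
  - by rewrite grid_endE//; case/andP: ux.
  rewrite /g (bigD1 (Ordinal j_n))//= lee_paddr//.
    by apply: sume_ge0 => k _; rewrite lee_fin mulr_ge0// c0// ltnW.
  rewrite indicE mem_set ?mulr1/=; last by rewrite /I/= in_itv/= ju uj.
  rewrite lee_fin /c.
  have jI : j%:R * d <= u <= j.+1%:R * d by rewrite ju.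
  have := lcmaj_grid_le x0 n0 w0 osc energy j_n jI.
  have := gcmin_grid_ge j_n jI.
  by rewrite -/M -/m; lra.
rewrite /g ge0_integral_sum//; last 2 first.
- move=> i; apply/measurable_EFinP; apply: measurable_funM => //.
  by apply: measurable_indic; exact: measurable_itv.
- by move=> i u _; rewrite lee_fin mulr_ge0// c0// ltnW.
have -> : d * \sum_(i < n) (M i - m i) + 4 * w * x = \sum_(i < n) c i * d.
  rewrite -mulr_suml [in RHS]big_split/= big_const_ord iter_addr_0.
  have E := grid_endE x n0; move: (\sum_(_ < _) _) => S.
  by set dd := x / _ in E *; rewrite -E -mulr_natr; ring.
rewrite -sumEFin; apply: lee_sum => i _.
have mI : measurable (I i) by exact: measurable_itv.
rewrite (@integralZl_indic _ _ _ lebesgue_measure _ _ (fun=> I i) (c i))//; last first.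
  by rewrite ltNge c0// ltnW.
rewrite integral_indic// EFinM lee_wpmul2l ?lee_fin ?c0 ?(ltnW (ltn_ord i))//.
apply: (@le_trans _ _ (lebesgue_measure (I i))).
  by apply: le_measure; rewrite ?inE//; exact: measurableI.
rewrite lebesgue_measure_itv/= lte_fin; case: ifPn => _; last first.
  by rewrite lee_fin ltW.
by rewrite -EFinD lee_fin -natr1; lra.
Qed.

End AreaBound.

End HullArea.

(** * The parabola *)

Section Parabola.
Variable R : realType.
Implicit Types (a b c k x u v : R).

(** The integrands for the parabola are quadratic, so cubics without constant term serve as
    primitives. *)
Lemma is_derive_cubic a b c u :
  is_derive u 1 (fun v => a * v ^+ 3 + b * v ^+ 2 + c * v : R)
    (3 * a * u ^+ 2 + 2 * b * u + c).
Proof.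
have d1 : is_derive u 1 (id : R -> R) 1 := is_derive_id u 1.
have := is_deriveD (is_deriveD (is_deriveZ a (is_deriveX 3 d1))
  (is_deriveZ b (is_deriveX 2 d1))) (is_deriveZ c d1).
rewrite (_ : a \*: _ + _ + _ = fun v => a * v ^+ 3 + b * v ^+ 2 + c * v).
  by rewrite (_ : _ *: _ + _ + _ = 3 * a * u ^+ 2 + 2 * b * u + c)// /GRing.scale/=; ring.
by apply/funext => v; rewrite !fctE.
Qed.

Lemma derive1_cubic a b c u :
  derive1 (fun v => a * v ^+ 3 + b * v ^+ 2 + c * v : R) u =
  3 * a * u ^+ 2 + 2 * b * u + c.
Proof. by rewrite derive1E; case: (is_derive_cubic a b c u). Qed.

Lemma continuous_cubic a b c : continuous (fun v => a * v ^+ 3 + b * v ^+ 2 + c * v : R).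
Proof.
move=> u; apply: differentiable_continuous; apply/derivable1_diffP.
by case: (is_derive_cubic a b c u).
Qed.

Lemma integral_quadratic x a b c : 0 < x ->
  (\int[lebesgue_measure]_(u in `[0%R, x]) (3 * a * u ^+ 2 + 2 * b * u + c)%:E =
   (a * x ^+ 3 + b * x ^+ 2 + c * x)%:E)%E.
Proof.
move=> x0; pose F v : R := a * v ^+ 3 + b * v ^+ 2 + c * v.
rewrite (@continuous_FTC2 _ _ F)//.
- by rewrite /F !expr0n/= !mulr0 !addr0 sube0.
- have -> : (fun u => 3 * a * u ^+ 2 + 2 * b * u + c) =
      (fun u => 0 * u ^+ 3 + (3 * a) * u ^+ 2 + (2 * b) * u) \+ cst c.
    by apply/funext => u /=; ring.
  apply: continuous_subspaceT => u; apply: continuousD; last exact: cst_continuous.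
  exact: continuous_cubic.
- split.
  + by move=> u _; case: (is_derive_cubic a b c u).
  + by apply: cvg_at_right_filter; exact: continuous_cubic.
  + by apply: cvg_at_left_filter; exact: continuous_cubic.
- by move=> u _; rewrite derive1_cubic.
Qed.

(** * Energy and hull of the extremal parabola *)

Section Fstar.
Variables (x gamma : R).
Hypotheses (x0 : 0 < x) (gamma0 : 0 < gamma).

Local Notation k := (Num.sqrt (3 * gamma / x ^+ 3)).

Lemma fstar_coef_gt0 : 0 < k.
Proof. by rewrite sqrtr_gt0 divr_gt0 ?mulr_gt0 ?exprn_gt0. Qed.

Lemma fstar_coef_sqr : k ^+ 2 * x ^+ 3 = 3 * gamma.
Proof.
rewrite sqr_sqrtr; last by rewrite divr_ge0 ?exprn_ge0 ?mulr_ge0// ltW.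
by rewrite divfK// expf_neq0// gt_eqF.
Qed.

Lemma fstar_coef_area : k * x ^+ 3 / 6 = Num.sqrt (3 * gamma * x ^+ 3) / 6.
Proof.
congr (_ / _); apply/eqP; rewrite -(@eqrXn2 _ 2) ?sqrtr_ge0//; last first.
  by rewrite mulr_ge0 ?sqrtr_ge0// exprn_ge0// ltW.
rewrite (@sqr_sqrtr _ (3 * gamma * x ^+ 3)) ?mulr_ge0 ?exprn_ge0 ?(ltW x0) ?(ltW gamma0)//.
by have := fstar_coef_sqr; set K := Num.sqrt _ => <-; apply/eqP; ring.
Qed.

Lemma fstarE : fstar x gamma = (fun u => 0 * u ^+ 3 + (- k) * u ^+ 2 + (k * x) * u).
Proof. by apply/funext => u; rewrite /fstar; ring. Qed.

Lemma fstar_ge0 u : 0 <= u <= x -> 0 <= fstar x gamma u.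
Proof.
by move=> /andP[u0 ux]; rewrite /fstar !mulr_ge0 ?subr_ge0// ltW// fstar_coef_gt0.
Qed.

Lemma Gamma_fstar : Gamma x (fstar x gamma) = gamma%:E.
Proof.
rewrite /Gamma fstarE.
transitivity (\int[lebesgue_measure]_(u in `[0%R, x])
  (3 * (4 * k ^+ 2 / 3) * u ^+ 2 + 2 * (- 2 * k ^+ 2 * x) * u + k ^+ 2 * x ^+ 2)%:E)%E.
  by apply: eq_integral => u _; rewrite derive1_cubic; congr EFin; field.
rewrite integral_quadratic//; congr EFin.
have := fstar_coef_sqr; set K := Num.sqrt _ => E.
rewrite (_ : _ + _ = K ^+ 2 * x ^+ 3 / 3); last by field.
by rewrite E; field.
Qed.

(** Lipschitz continuity with constant [k * x]. *)
Lemma fstar_abs_cont : abs_cont_on 0 x (fstar x gamma).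
Proof.
move: fstar_coef_gt0; rewrite /fstar; set K := Num.sqrt _ => k0.
have kx0 : 0 < K * x by rewrite mulr_gt0.
move=> e e0; exists (e / (K * x)); first by rewrite divr_gt0.
move=> n s t st _ lt; apply: (@le_lt_trans _ _ ((K * x) * \sum_(i < n) (t i - s i))).
  rewrite mulr_sumr; apply: ler_sum => i _.
  have [s0 [sti tx]] := st i (ltn_ord i).
  rewrite (_ : _ - _ = K * ((t i - s i) * (x - t i - s i))); last by ring.
  rewrite normrM gtr0_norm// -mulrA ler_pM2l// normrM mulrC.
  rewrite (@ger0_norm _ (t i - s i)) ?subr_ge0// ler_wpM2r ?subr_ge0//.
  by rewrite ler_norml; lra.
by rewrite mulrC -ltr_pdivlMr.
Qed.

Lemma Acl_fstar : Acl x (fstar x gamma).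
Proof.
split; first exact: fstar_abs_cont.
by split; [rewrite /fstar mulr0 mul0r|rewrite Gamma_fstar ltry].
Qed.

(** The concavity defect of the parabola is [k * (t * (1 - t) * (p - q) ^+ 2)], so it is its own
    majorant. *)
Lemma lcmaj_fstar u : 0 <= u <= x -> lcmaj x (fstar x gamma) u = fstar x gamma u.
Proof.
move=> ux; apply/eqP; rewrite eq_le; apply/andP; split.
  apply: lcmaj_le => // p q t _ _ /andP[t0 t1]; rewrite -subr_ge0 /fstar.
  rewrite [leRHS](_ : _ = k * (t * (1 - t) * (p - q) ^+ 2)); last by ring.
  have t1' : 0 <= 1 - t by rewrite subr_ge0.
  by rewrite mulr_ge0 ?sqrtr_ge0// mulr_ge0 ?sqr_ge0// mulr_ge0.
apply: (@lcmaj_ge _ _ _ (k * x * x)) => // v /andP[v0 vx].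
move: fstar_coef_gt0; rewrite /fstar; set K := Num.sqrt _ => k0.
by rewrite -!mulrA ler_pM2l//; nra.
Qed.

(** Zero is a concave majorant of [- fstar], and any other is nonnegative at [0] and [x], hence in
    between. *)
Lemma gcmin_fstar u : 0 <= u <= x -> gcmin x (fstar x gamma) u = 0.
Proof.
have f0 : fstar x gamma 0 = 0 by rewrite /fstar mulr0 mul0r.
have fx : fstar x gamma x = 0 by rewrite /fstar subrr mulr0.
move=> /[dup] ux /andP[u0 ux']; rewrite gcminE; apply/eqP; rewrite oppr_eq0 eq_le.
apply/andP; split.
  apply: (@lcmaj_le _ _ _ (cst 0)) => //=; first by move=> p q t _ _ _; rewrite !mulr0 addr0.
  by move=> v /fstar_ge0; rewrite oppr_le0.
apply: lb_le_inf.
  exists 0, (cst 0) => //=; split; first by move=> p q t _ _ _; rewrite !mulr0 addr0.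
  by move=> v /fstar_ge0; rewrite oppr_le0.
move=> _ [h [ch fh] <-].
have h0 : 0 <= h 0 by have := fh 0; rewrite /= f0 oppr0 lexx ltW//; apply.
have hx : 0 <= h x by have := fh x; rewrite /= fx oppr0 lexx ltW//; apply.
have t0 : 0 <= u / x by rewrite divr_ge0// ltW.
have t1 : u / x <= 1 by rewrite ler_pdivrMr// mul1r.
have := ch x 0 (u / x); rewrite !lexx (ltW x0) t0 t1 mulr0 addr0 divfK ?gt_eqF//.
move=> /(_ erefl erefl erefl); apply: le_trans.
by rewrite addr_ge0// mulr_ge0// subr_ge0.
Qed.

Lemma Area_fstar : Area x (fstar x gamma) = (k * x ^+ 3 / 6)%:E.
Proof.
rewrite /Area.
transitivity (\int[lebesgue_measure]_(u in `[0%R, x])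
  (3 * 0 * u ^+ 2 + 2 * 0 * u + 0 + (3 * (- k / 3) * u ^+ 2 + 2 * (k * x / 2) * u + 0))%:E)%E.
  apply: eq_integral => u; rewrite inE/= in_itv/= => ux.
  by rewrite lcmaj_fstar// gcmin_fstar//; congr EFin; rewrite /fstar; field.
transitivity (\int[lebesgue_measure]_(u in `[0%R, x])
  (3 * (- k / 3) * u ^+ 2 + 2 * (k * x / 2) * u + 0)%:E)%E.
  by apply: eq_integral => u _; congr EFin; ring.
by rewrite integral_quadratic//; congr EFin; field.
Qed.

End Fstar.

End Parabola.

(** * Optimality and uniqueness *)

Section Extremal.
Variable R : realType.
Variables (x gamma : R) (f : R -> R).
Hypotheses (x0 : 0 < x) (gamma0 : 0 < gamma).
Hypotheses (f0 : f 0 = 0) (acf : abs_cont_on 0 x f).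
Hypothesis Gf : (Gamma x f <= gamma%:E)%E.

Local Notation k := (Num.sqrt (3 * gamma / x ^+ 3)).
Local Notation P := (fstar x gamma).
Local Notation step n := (x / n%:R).
Local Notation gr n := (fun i : nat => f (i%:R * step n)).
Local Notation M n := (seq_cmaj n (gr n)).
Local Notation m n := (seq_cmin n (gr n)).
Local Notation D n i := (M n i - m n i).
Local Notation w n := (Num.sqrt (gamma * step n)).

Let stepE n (n0 : (0 < n)%N) : n%:R * step n = x := grid_endE x n0.

Let step0 n (n0 : (0 < n)%N) : 0 < step n := grid_step_gt0 x0 n0.

Let w_sqr n : w n ^+ 2 = gamma * step n.
Proof. by rewrite sqr_sqrtr// mulr_ge0// ?divr_ge0// ltW. Qed.

Let k0 : 0 < k := fstar_coef_gt0 x0 gamma0.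

(** Hoelder continuity of exponent 1/2: increments of [e] are at most [e x - e 0 <= gamma]. *)
Lemma fdist_sqr_le u v : 0 <= u <= x -> 0 <= v <= x ->
  (f v - f u) ^+ 2 <= gamma * `|v - u|.
Proof.
have [e [e00 ex eE]] := ac_energy x0 acf Gf.
wlog uv : u v / u <= v => [hw ux vx|/andP[u0 _] /andP[_ vx]].
  have [uv|/ltW vu] := leP u v; first exact: hw.
  by rewrite -sqrrN opprB distrC hw.
have [_ le1] := eE u v u0 uv vx; rewrite ger0_norm ?subr_ge0// mulrC.
apply: (le_trans le1); rewrite ler_wpM2l ?subr_ge0//.
have [e0u _] := eE 0 u (lexx _) u0 (le_trans uv vx).
have [evx _] := eE v x (le_trans u0 uv) vx (lexx _).
by lra.
Qed.

Lemma grid_in n i : (0 < n)%N -> (i <= n)%N -> 0 <= i%:R * step n <= x.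
Proof.
move=> n0 i_n; rewrite mulr_ge0//=; last exact/ltW/step0.
by rewrite -[leRHS](stepE n0) ler_wpM2r ?ler_nat// ltW// step0.
Qed.

(** [w n] is the Hoelder bound at distance [step n]. *)
Lemma grid_osc n i u : (0 < n)%N -> (i < n)%N ->
  i%:R * step n <= u <= i.+1%:R * step n ->
  `|f u - f (i%:R * step n)| <= w n /\ `|f u - f (i.+1%:R * step n)| <= w n.
Proof.
move=> n0 i_n /andP[iu ui].
have /andP[i0 _] := grid_in n0 (ltnW i_n); have /andP[_ i1x] := grid_in n0 i_n.
have ux : 0 <= u <= x by rewrite (le_trans i0 iu) (le_trans ui i1x).
have dist j : (j <= n)%N -> `|u - j%:R * step n| <= step n ->
    `|f u - f (j%:R * step n)| <= w n.
  move=> jn h; rewrite -[leRHS]ger0_norm ?sqrtr_ge0// -ler_sqr ?nnegrE//.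
  rewrite !real_normK ?num_real// w_sqr.
  by rewrite (le_trans (fdist_sqr_le (grid_in n0 jn) ux))// ler_pM2l.
have s1 : i.+1%:R * step n = i%:R * step n + step n by rewrite -natr1; ring.
split; apply: dist => //; first exact: ltnW.
  by rewrite ger0_norm ?subr_ge0//; lra.
by rewrite ler0_norm ?subr_le0//; lra.
Qed.

(** Each squared increment is at most [step n] times an increment of [e], and these telescope. *)
Lemma grid_energy n : (0 < n)%N ->
  \sum_(i < n) (f (i.+1%:R * step n) - f (i%:R * step n)) ^+ 2 <= w n ^+ 2.
Proof.
move=> n0; have [e [e00 ex eE]] := ac_energy x0 acf Gf; rewrite w_sqr.
apply: (@le_trans _ _ (step n * \sum_(i < n) (e (i.+1%:R * step n) - e (i%:R * step n)))).
  rewrite mulr_sumr; apply: ler_sum => i _.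
  have /andP[i0 _] := grid_in n0 (ltnW (ltn_ord i)).
  have /andP[_ i1x] := grid_in n0 (ltn_ord i).
  have s1 : i.+1%:R * step n = i%:R * step n + step n by rewrite -natr1; ring.
  have [|_] := eE _ _ i0 _ i1x; first by rewrite s1 lerDl ltW// step0.
  by have -> : i.+1%:R * step n - i%:R * step n = step n by rewrite s1; ring.
have := @telescope_sumr R 0 n (fun i => e (i%:R * step n)) (leq0n _).
rewrite big_mkord => ->; rewrite stepE// mul0r e00 subr0 mulrC ler_pM2r//.
exact: step0.
Qed.

(** The central estimate: the distances from [D] to [P] and from [f] to [M + m] are controlled by
    how far the discrete hull area falls short of the area of [P]. It adds [sum_dist_parabola_le] to
    [seq_hull_energy]. *)
Lemma hull_gap_le n : (0 < n)%N ->
  \sum_(i < n) ((D n i.+1 - P (i.+1%:R * step n)) - (D n i - P (i%:R * step n))) ^+ 2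
  + \sum_(i < n) ((gr n i.+1 - M n i.+1 - m n i.+1) - (gr n i - M n i - m n i)) ^+ 2
  <= step n * (2 * gamma - 4 * k * (step n * \sum_(i < n) D n i)).
Proof.
move=> n0; set d := step n; have nd := stepE n0; rewrite -/d in nd.
have D0 : D n 0 = 0 by rewrite /seq_cmin !seq_cmaj0; ring.
have Dn : D n n = 0 by rewrite /seq_cmin !seq_cmajn; ring.
(* The factor [2 * k * d ^+ 2] makes the slopes those of [P] on the grid, see [SpE]. *)
have Sple := @sum_dist_parabola_le R n (fun i => D n i) (2 * k * d ^+ 2) D0 Dn.
have Eq := seq_hull_energy n (gr n); have Sfle := grid_energy n0.
rewrite w_sqr -/d /= in Sfle Eq Sple *.
have SpE : \sum_(i < n) ((D n i.+1 - P (i.+1%:R * d)) - (D n i - P (i%:R * d))) ^+ 2 =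
    \sum_(i < n) ((D n i.+1 - D n i) - 2 * k * d ^+ 2 * ((n%:R - 1) / 2 - i%:R)) ^+ 2.
  apply: eq_bigr => i _; congr (_ ^+ 2); rewrite /fstar -[i.+1%:R]natr1.
  by move: (Num.sqrt _) => K; rewrite -nd; field.
have kd : (2 * k * d ^+ 2) ^+ 2 * n%:R ^+ 3 / 12 = d * gamma.
  have := fstar_coef_sqr x0 gamma0; move: (Num.sqrt _) => K' KE; move: KE.
  rewrite (_ : _ / 12 = d * (K' ^+ 2 * (n%:R * d) ^+ 3) / 3); last by field.
  by rewrite nd => ->; field.
rewrite SpE; apply: (le_trans (lerD Sple (lexx _))).
rewrite kd addrAC addrAC [X in X <= _](_ : _ =
  \sum_(i < n) (gr n i.+1 - gr n i) ^+ 2 - 2 * (2 * k * d ^+ 2) * \sum_(i < n) D n i + d * gamma).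
  by move: Sfle; rewrite -/d; move: (\sum_(_ < _) _) => ?; move: (\sum_(_ < _) _) => ?; lra.
by rewrite /= -Eq; ring.
Qed.

Lemma exists_fine_grid (eps : R) : 0 < eps ->
  exists n, [/\ (0 < n)%N, step n <= eps & w n <= eps].
Proof.
move=> e0; pose c := Num.max (x / eps) (gamma * x / eps ^+ 2).
pose n := (Num.truncn c).+1; have n0 : (0 : R) < n%:R by rewrite ltr0n.
have cn : c <= n%:R by rewrite ltW// truncnS_gt.
exists n; split => //.
  rewrite ler_pdivrMr// -ler_pdivrMl// mulrC; apply: le_trans cn.
  by rewrite le_max lexx.
rewrite -ler_sqr ?nnegrE ?sqrtr_ge0 ?(ltW e0)// w_sqr mulrA ler_pdivrMr//.
rewrite -ler_pdivrMl ?exprn_gt0// mulrC; apply: le_trans cn.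
by rewrite le_max lexx orbT.
Qed.

Lemma Area_le_grid n : (0 < n)%N ->
  (Area x f <= (step n * \sum_(i < n) D n i + 4 * w n * x)%:E)%E.
Proof.
move=> n0; apply: Area_grid_le => //.
  by move=> i u; exact: grid_osc.
exact: grid_energy.
Qed.

Lemma grid_area_le n : (0 < n)%N -> 4 * k * (step n * \sum_(i < n) D n i) <= 2 * gamma.
Proof.
move=> n0; rewrite -subr_ge0 -(pmulr_rge0 _ (step0 n0)).
apply: le_trans (hull_gap_le n0).
by rewrite addr_ge0// sumr_ge0// => i _; exact: sqr_ge0.
Qed.

(** Identifies the bound of [grid_area_le] as [4 * k] times the hull area of [P]. *)
Lemma fstar_coef_areaE : 4 * k * (k * x ^+ 3 / 6) = 2 * gamma.
Proof.
have := fstar_coef_sqr x0 gamma0; move: (Num.sqrt _) => K KE.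
by transitivity (2 / 3 * (K ^+ 2 * x ^+ 3)); [field|rewrite KE; field].
Qed.

Lemma Area_le_fstar : (Area x f <= Area x P)%E.
Proof.
rewrite Area_fstar//; apply/lee_addgt0Pr => e e0.
(* Chosen so that the discretisation error [4 * w n * x] is at most [e]. *)
have e40 : 0 < e / (4 * x) by rewrite divr_gt0// mulr_gt0.
have [n [n0 _ wn]] := exists_fine_grid e40.
apply: (le_trans (Area_le_grid n0)); rewrite -EFinD lee_fin lerD//.
  have k40 : 0 < 4 * k by rewrite mulr_gt0.
  by rewrite -(ler_pM2l k40) fstar_coef_areaE grid_area_le.
by move: wn; rewrite ler_pdivlMr ?mulr_gt0//; lra.
Qed.

(** * The case of equality *)

Hypothesis Af : Area x f = Area x P.

(** Equality of areas makes the right side of [hull_gap_le] of order [step n * w n]; the factor [n]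
    from [sqr_le_sum_sqr] is absorbed by [n * step n = x]. *)
Lemma hull_approximation (eps : R) : 0 < eps ->
  exists n, [/\ (0 < n)%N, step n <= eps, w n <= eps &
    forall j, (j <= n)%N -> `|D n j - P (j%:R * step n)| <= eps /\
      `|gr n j - M n j - m n j| <= eps].
Proof.
(* The bound [w n <= c] is [16 * k * x ^+ 2 * w n <= eps ^+ 2] solved for [w n]. *)
move=> e0; pose c := eps ^+ 2 / (16 * k * x ^+ 2).
have c0 : 0 < c by rewrite divr_gt0 ?exprn_gt0// !mulr_gt0// exprn_gt0.
have [n [n0 dn]] := @exists_fine_grid (Num.min eps c) ltac:(by rewrite lt_min e0).
move: dn; rewrite !le_min => /andP[de _] /andP[we wc].
exists n; split => // j j_n; set d := step n in de *.
have d0 : 0 < d := step0 n0.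
have lb : k * x ^+ 3 / 6 - 4 * w n * x <= d * \sum_(i < n) D n i.
  by have := Area_le_grid n0; rewrite Af Area_fstar// lee_fin -/d; lra.
have := hull_gap_le n0; rewrite -/d.
set S1 := \sum_(_ < _) _; set S2 := \sum_(_ < n) (_ - (_ - _ - _)) ^+ 2.
move=> S12.
have S10 : 0 <= S1 by rewrite sumr_ge0// => i _; exact: sqr_ge0.
have S20 : 0 <= S2 by rewrite sumr_ge0// => i _; exact: sqr_ge0.
have Sle : n%:R * (S1 + S2) <= eps ^+ 2.
  apply: (@le_trans _ _ (16 * k * x ^+ 2 * w n)); last first.
    have kx0 : 0 < 16 * k * x ^+ 2 by rewrite mulr_gt0 ?exprn_gt0// mulr_gt0.
    by rewrite mulrC -ler_pdivlMr.
  have : S1 + S2 <= d * (16 * k * w n * x).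
    apply: (le_trans S12); rewrite ler_pM2l//.
    have k40 : 0 < 4 * k by rewrite mulr_gt0.
    have := ler_wpM2l (ltW k40) lb; rewrite mulrBr fstar_coef_areaE.
    by lra.
  move=> /(ler_wpM2l (ler0n R n)) /le_trans; apply.
  rewrite [leLHS]mulrA (_ : n%:R * d = x); last exact: stepE.
  by rewrite le_eqVlt; apply/orP; left; apply/eqP; move: (w n) k => w' k'; ring.
have nS1 : n%:R * S1 <= eps ^+ 2.
  by apply: le_trans Sle; rewrite ler_wpM2l// lerDl.
have nS2 : n%:R * S2 <= eps ^+ 2.
  by apply: le_trans Sle; rewrite ler_wpM2l// lerDr.
split; rewrite -ler_sqr ?nnegrE ?normr_ge0 ?(ltW e0)// real_normK ?num_real//.
  apply: le_trans nS1.
  apply: (@sqr_le_sum_sqr R n j (fun i => D n i - P (i%:R * d))) => //.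
  by rewrite /seq_cmin !seq_cmaj0 /fstar !mul0r mulr0; ring.
apply: le_trans nS2.
apply: (@sqr_le_sum_sqr R n j (fun i => gr n i - M n i - m n i)) => //.
by rewrite /seq_cmin !seq_cmaj0 !mul0r f0; ring.
Qed.

Lemma fstar_lipschitz u v : 0 <= u <= x -> 0 <= v <= x ->
  `|P u - P v| <= k * x * `|u - v|.
Proof.
rewrite /fstar => /andP[? ?] /andP[? ?].
rewrite (_ : _ - _ = k * (x - u - v) * (u - v)); last by ring.
rewrite normrM ler_wpM2r// normrM (gtr0_norm k0) ler_pM2l// ler_norml; lra.
Qed.

(** Up to small errors [f = M + m] and [P = M - m]. As [m <= f <= M], this forces [m <= 0 <= M],
    whence [|M + m| <= M - m]. *)
Lemma norm_le_fstar u : 0 <= u <= x -> `|f u| <= P u.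
Proof.
move=> ux; apply/ler_addgt0Pr => e e0.
(* Two [eps] come from the hulls, one from the oscillation of [f], and [k * x * eps] from that of
   [P]. *)
have c0 : 0 < 3 + k * x by rewrite addr_gt0// mulr_gt0.
have [n [n0 de we H]] := hull_approximation (divr_gt0 e0 c0).
set eps := e / (3 + k * x) in de we H.
have eE : e = 3 * eps + k * x * eps.
  by rewrite -mulrDl /eps mulrC divfK// gt_eqF.
have /andP[u0 u_x] := ux.
have [|j [j_n ju uj]] := @grid_cell R (step n) n u n0 u0; first by rewrite stepE.
have [|+ _] := grid_osc n0 j_n (u := u); first by rewrite ju.
move=> /le_trans/(_ we); rewrite ler_norml => /andP[fj1 fj2].
have [] := H j (ltnW j_n); rewrite !ler_norml => /andP[h1 h2] /andP[h3 h4].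
have jM := seq_cmaj_ge (gr n) (ltnW j_n).
have jm := seq_cmaj_ge (fun i => - gr n i) (ltnW j_n).
rewrite /= in jM jm h1 h2 h3 h4.
have := fstar_lipschitz (grid_in n0 (ltnW j_n)) ux.
have dist : `|j%:R * step n - u| <= eps.
  apply: le_trans de; rewrite distrC ger0_norm ?subr_ge0//.
  by move: uj; rewrite -natr1 mulrDl mul1r; lra.
have kx : k * x * `|j%:R * step n - u| <= k * x * eps.
  by rewrite ler_wpM2l// mulr_ge0 ?ltW.
move=> /le_trans/(_ kx); rewrite ler_norml => /andP[p1 p2].
rewrite eE; move: h1 h2 h3 h4 jm; rewrite /seq_cmin.
by lra.
Qed.

Lemma gap_neighborhood u : 0 < u < x -> `|f u| < P u ->
  exists c r, [/\ 0 < c, 0 < r, 2 * r <= u, 2 * r <= x - u &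
    forall v, `|v - u| <= 2 * r -> `|f v| + c <= P v].
Proof.
move=> /andP[u0 ux] lt.
pose c := (P u - `|f u|) / 4; have c0 : 0 < c by rewrite divr_gt0 ?subr_gt0.
have kx0 : 0 < k * x by rewrite mulr_gt0.
(* The first two terms keep [v] in [[0, x]]; the others bound the changes of [P] (Lipschitz) and of
   [f] (Hoelder) by [c], a quarter of the gap. *)
pose r := Num.min (Num.min (u / 2) ((x - u) / 2))
                  (Num.min (c / (2 * (k * x))) (c ^+ 2 / (2 * gamma))).
have r0 : 0 < r.
  by rewrite !lt_min !divr_gt0 ?subr_gt0 ?exprn_gt0 ?(mulr_gt0 _ kx0) ?(mulr_gt0 _ gamma0).
have : r <= r by []; rewrite {2}/r !le_min => /andP[/andP[r1 r2] /andP[r3 r4]].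
rewrite !ler_pdivlMr// in r1 r2.
rewrite ler_pdivlMr ?(mulr_gt0 _ kx0)// in r3.
rewrite ler_pdivlMr ?(mulr_gt0 _ gamma0)// in r4.
exists c, r; split => //; [by rewrite mulrC|by rewrite mulrC|move=> v vu].
have uI : 0 <= u <= x by rewrite !ltW.
have vI : 0 <= v <= x.
  by move: vu r1 r2; rewrite ler_norml => /andP[? ?] ? ?; apply/andP; split; lra.
have dP : `|P v - P u| <= c.
  apply: (le_trans (fstar_lipschitz vI uI)).
  apply: (le_trans (ler_wpM2l (ltW kx0) vu)).
  by rewrite (_ : k * x * (2 * r) = r * (2 * (k * x)))//; ring.
have df : `|f v - f u| <= c.
  rewrite -ler_sqr ?nnegrE ?normr_ge0 ?(ltW c0)// real_normK ?num_real//.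
  apply: (le_trans (fdist_sqr_le uI vI)).
  apply: (le_trans (ler_wpM2l (ltW gamma0) vu)).
  by rewrite (_ : gamma * (2 * r) = r * (2 * gamma))//; ring.
have := ler_normD (f v - f u) (f u); rewrite subrK.
have cE : `|f u| + 4 * c = P u by rewrite /c; field.
move: c0 dP cE df; rewrite ler_norml => + /andP[+ _].
by lra.
Qed.

(** With [M - m] near [P] and [M + m] near [f], the gap puts [M] strictly above [f] and [m] strictly
    below, so both have zero second difference. *)
Lemma hull_gap_affine n (eps : R) j : (j.+2 <= n)%N ->
  `|D n j.+1 - P (j.+1%:R * step n)| <= eps ->
  `|gr n j.+1 - M n j.+1 - m n j.+1| <= eps ->
  `|f (j.+1%:R * step n)| + 2 * eps < P (j.+1%:R * step n) ->
  D n j + D n j.+2 = 2 * D n j.+1.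
Proof.
move=> jn; have f1 := ler_norm (f (j.+1%:R * step n)).
have f2 := ler_norm (- f (j.+1%:R * step n)); rewrite normrN in f2.
have s1 := @seq_cmaj_slack R n (gr n) j jn.
have s2 := @seq_cmaj_slack R n (fun t => - gr n t) j jn.
rewrite /seq_cmin !ler_norml => /andP[h1 _] /andP[h3 h4] lt.
have {}s1 : M n j + M n j.+2 = 2 * M n j.+1.
  by apply: s1; move: f1 f2 h1 h3 h4 lt => /=; lra.
have {}s2 := s2 ltac:(move: f1 f2 h1 h3 h4 lt => /=; lra).
by move: s1 s2; lra.
Qed.

(* Where [|f| < P] both hulls detach from [f] and are therefore affine, whereas
   their difference has to be the strictly concave [P]. *)
Lemma fstar_le_norm u : 0 < u < x -> P u <= `|f u|.
Proof.
move=> u0x; rewrite leNgt; apply/negP => /(gap_neighborhood u0x).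
move=> [c [r [c0 r0 r1 r2 nearu]]]; have /andP[u0 ux] := u0x.
(* [c / 4] gives the margin for [hull_gap_affine] and [r / 4] a grid fine relative to [r]. With
   [k * r ^+ 2 / 16] the errors at three points, at most [4 * eps] in a second difference, stay
   below the [k * r ^+ 2 / 2] that [P] shows at distance [r / 2]. *)
pose eps := Num.min (c / 4) (Num.min (r / 4) (k * r ^+ 2 / 16)).
have kr0 : 0 < k * r ^+ 2 by rewrite mulr_gt0// exprn_gt0.
have e0 : 0 < eps by rewrite !lt_min !divr_gt0.
have : eps <= eps by []; rewrite {2}/eps !le_min => /and3P[e1 e2 e3].
have [n [n0 de _ H]] := hull_approximation e0.
set d := step n in de H; have d0 : 0 < d := step0 n0; have nd : n%:R * d = x := stepE n0.
have dr : d <= r / 4 := le_trans de e2.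
have [|i [i_n iu ui]] := @grid_cell R d n u n0 (ltW u0); first by rewrite nd ltW.
(* The window of indices from [i - l] to [i + l] stays within [2 * r] of [u] and reaches at least
   [r / 2] to each side of [i]; [li] below makes the natural subtraction exact. *)
have [|l [l_n lr rl]] := @grid_cell R d n r n0 (ltW r0).
  by rewrite nd; move: r0 r1 ux; lra.
rewrite -natr1 mulrDl mul1r in ui; rewrite -natr1 mulrDl mul1r in rl.
have li : (l <= i)%N.
  by rewrite -(ler_nat R) -(ler_pM2r d0); move: lr ui r0 r1 dr; lra.
have il_n : (i + l <= n)%N.
  rewrite -(ler_nat R) -(ler_pM2r d0) natrD mulrDl nd.
  by move: lr iu r0 r2; lra.
have close j : (i - l <= j <= i + l)%N -> `|j%:R * d - u| <= 2 * r.
  move=> /andP[j1 j2].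
  have : (i - l)%:R * d <= j%:R * d by rewrite ler_pM2r// ler_nat.
  have : j%:R * d <= (i + l)%:R * d by rewrite ler_pM2r// ler_nat.
  rewrite natrB// natrD mulrBl mulrDl ler_norml; move: lr iu ui r0 dr.
  by move=> *; apply/andP; split; lra.
have slack j : (i - l <= j)%N -> (j.+2 <= i + l)%N -> D n j + D n j.+2 = 2 * D n j.+1.
  move=> j1 j2; have jn : (j.+2 <= n)%N by exact: leq_trans il_n.
  have [h1 h2] := H j.+1 (ltnW jn); apply: (hull_gap_affine jn h1 h2).
  have /close/nearu : (i - l <= j.+1 <= i + l)%N by rewrite leqW// ltnW.
  by apply: lt_le_trans; rewrite ltrD2l; move: c0 e1; lra.
have Dl t : (t <= l + l)%N -> D n (i - l + t) = D n (i - l) + t%:R * (D n (i - l).+1 - D n (i - l)).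
  move=> tl; apply: (@seq_affine R (fun j => D n j) (i - l)%N (i + l)%N slack).
  by rewrite -(subnK li) addnK -addnA leq_add2l.
have E1 := Dl l (leq_addr _ _); have E2 := Dl (l + l)%N (leqnn _).
rewrite (subnK li) in E1; rewrite addnA (subnK li) natrD in E2.
have E : D n (i + l) + D n (i - l) = 2 * D n i by rewrite E1 E2; ring.
have [Ha _] := H (i - l)%N (leq_trans (leq_subr _ _) (ltnW i_n)).
have [Hb _] := H i (ltnW i_n); have [Hc _] := H (i + l)%N il_n.
have Pl : P ((i - l)%:R * d) + P ((i + l)%:R * d) - 2 * P (i%:R * d) =
    - 2 * (k * (l%:R * d) ^+ 2) by rewrite natrB// natrD /fstar; ring.
have rl2 : k * (r / 2) ^+ 2 <= k * (l%:R * d) ^+ 2.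
  have rld : r / 2 <= l%:R * d by move: rl r0 dr; lra.
  have r20 : 0 <= r / 2 by rewrite divr_ge0// ltW.
  by rewrite ler_pM2l// !expr2 ler_pM.
move: rl2 Pl E Ha Hb Hc e3 kr0.
rewrite (_ : k * (r / 2) ^+ 2 = k * r ^+ 2 / 4); last by field.
rewrite !ler_norml => + + + /andP[+ +] /andP[+ +] /andP[+ +].
by lra.
Qed.

(** Both signs occur: [- P] has the same energy and hull area as [P]. If [f] took both, it would
    vanish at some interior point, where [|f| = P > 0]. *)
Lemma eq_fstar_or_opp : (forall u, 0 <= u <= x -> f u = P u) \/
  (forall u, 0 <= u <= x -> f u = - P u).
Proof.
have P0 u : 0 < u < x -> 0 < P u.
  by move=> /andP[u0 ux]; rewrite /fstar mulr_gt0 ?subr_gt0// mulr_gt0.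
have fx : f x = 0.
  apply/eqP; rewrite -normr_le0; have := @norm_le_fstar x.
  by rewrite lexx ltW// /fstar subrr mulr0; apply.
have normE u : 0 <= u <= x -> f u = P u \/ f u = - P u.
  move=> /andP[u0 ux].
  move: u0; rewrite le_eqVlt => /predU1P[<-|u0]; first by left; rewrite f0 /fstar mulr0 mul0r.
  move: ux; rewrite le_eqVlt => /predU1P[->|ux]; first by left; rewrite fx /fstar subrr mulr0.
  have /eqP : `|f u| = P u.
    by apply/le_anti; rewrite norm_le_fstar ?fstar_le_norm ?u0 ?ux ?ltW.
  rewrite eqr_norml => /andP[/orP[/eqP|/eqP] ? _]; by [left|right].
have [|/existsNP[a /not_implyP[aI fa]]] := pselect (forall u, 0 <= u <= x -> f u = P u); first by left.
have [|/existsNP[b /not_implyP[bI fb]]] := pselect (forall u, 0 <= u <= x -> f u = - P u); first by right.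
have P_0 : P 0 = 0 by rewrite /fstar mulr0 mul0r.
have P_x : P x = 0 by rewrite /fstar subrr mulr0.
have interior u : 0 <= u <= x -> P u <> 0 -> 0 < u < x.
  rewrite !le_eqVlt => /andP[/predU1P[<-|->]]; first by rewrite P_0.
  by move=> /predU1P[->|->//]; rewrite P_x.
have faE : f a = - P a by case: (normE a aI).
have fbE : f b = P b by case: (normE b bI).
have a_in : 0 < a < x by apply: interior => // Pa; apply: fa; rewrite faE Pa oppr0.
have b_in : 0 < b < x by apply: interior => // Pb; apply: fb; rewrite fbE Pb oppr0.
have fa0 : f a < 0 by rewrite faE oppr_lt0 P0.
have fb0 : 0 < f b by rewrite fbE P0.
(* [f] is controlled on [[0, x]] only; [clamp] makes it continuous on the whole line for the
   intermediate value theorem. *)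
have cF : continuous (f \o clamp 0 x).
  by apply: ac_seq_clamp_continuous (ltW x0) _ => e e0; exact: abs_cont_mod.
have [a0 ax] := andP a_in; have [b0 bx] := andP b_in.
have [c cab /=] : exists2 c, c \in `[Num.min a b, Num.max a b] & (f \o clamp 0 x) c = 0.
  apply: IVT; [by rewrite ge_min le_max lexx|exact: continuous_subspaceT|].
  by case: (leP a b) => _ /=; rewrite !clamp_id// ge_min le_max (ltW fa0) (ltW fb0) ?orbT.
move: cab; rewrite in_itv/= ge_min le_max => cab.
have c_in : 0 < c < x.
  by case/andP: cab => /orP[?|?] /orP[?|?]; apply/andP; split; lra.
have cI : 0 <= c <= x by case/andP: c_in => /ltW -> /ltW ->.
rewrite clamp_id// => fc0; have := P0 c c_in.
by case: (normE c cI); rewrite fc0 => /esym; [|move/eqP; rewrite oppr_eq0 => /eqP]; move=> ->; rewrite ltxx.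
Qed.

End Extremal.

Unset Implicit Arguments.
Set Strict Implicit.

Theorem theorem5p1 (R : realType) (x gamma : R) (hx : 0 < x) (hg : 0 < gamma) :
  [/\ Acl x (fstar x gamma),
      Gamma x (fstar x gamma) = gamma%:E,
      Area x (fstar x gamma) = (Num.sqrt (3 * gamma * x ^+ 3) / 6)%:E,
      (forall f : R -> R, Acl x f -> (Gamma x f <= gamma%:E)%E ->
         (Area x f <= Area x (fstar x gamma))%E) &
      (forall f : R -> R, Acl x f -> (Gamma x f <= gamma%:E)%E ->
         Area x f = Area x (fstar x gamma) ->
         (forall u, 0 <= u <= x -> f u = fstar x gamma u) \/
         (forall u, 0 <= u <= x -> f u = - fstar x gamma u))].
Proof.
split.
- exact: Acl_fstar.
- exact: Gamma_fstar.
- by rewrite Area_fstar// fstar_coef_area.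
- by move=> f [acf [f0 _]] Gf; exact: Area_le_fstar.
- by move=> f [acf [f0 _]] Gf Af; exact: eq_fstar_or_opp.
Qed.
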